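(* Let $n$ and $2p$ be positive integers. Under the isomorphisms $T^{\mathbb{C}}M^f_{n,p}\cong E^\pm\otimes K^\pm$, the bilinear forms $g_\pm$, $\omega_{E^\pm}$, $\omega_{K^\pm}$ are related by $$g_\pm=\frac12\,\omega_{E^\pm}\otimes\omega_{K^\pm}.$$ For every nonzero $\psi\in K^+$ the bilinear form $g_+$ and the almost complex structure $J_{\langle\psi\rangle}$ are compatible in the sense that $$g_+(X,X)=0\qquad\text{for all }X\in T^{1,0}_{\langle\psi\rangle}M^f_{n,p}.$$
   Context: Monopoles. $H^3$ is oriented hyperbolic 3-space of sectional curvature $-1$, with Hodge star $*$ and sphere at infinity $S^2_\infty$, oriented as the boundary of $H^3$. $n$ and $2p$ are positive integers. A hyperbolic monopole of charge $n$ and mass $p$ is a pair $(A,\Phi)$, with $A$ an $\mathfrak{su}(2)$-valued 1-form (connection) and $\Phi$ an $\mathfrak{su}(2)$-valued function on the trivial rank 2 bundle $V$ over $H^3$, solving $d^A\Phi=*F^A$, such that $V,A,\Phi$ extend to $S^2_\infty$; $V|_{S^2_\infty}=L^+\oplus L^-$ with $c_1(L^\pm)=\pm n$; $L^\pm$ is the eigenbundle of $\Phi|_{S^2_\infty}$ with eigenvalue $\mp ip$; and $A|_{S^2_\infty}$ is a sum of $U(1)$ connections on $L^\pm$. Lift to $S^4$. $S^4\subset\mathbb{R}^5$ is the unit sphere; $t\in\mathbb{R}$ acts by rotation by angle $t$ in the $(y_1,y_2)$-plane, with fixed set $S^2=\{y_1=y_2=0\}$. Writing $y_1+iy_2=r_1e^{i\theta}$,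 the identity $r_1^{-2}g_{S^4}=d\theta^2+g_{H^3}$ identifies $S^4\setminus S^2$ conformally with $S^1\times H^3$ (orientation $d\theta\wedge\mathrm{Vol}_{H^3}$), and $S^2$ with $S^2_\infty$. $V\to S^4$ denotes the rank 2 $SU(2)$ bundle with a lift of the $\mathbb{R}$-action such that $t$ acts on $V|_{S^2}=L^+\oplus L^-$ by $e^{\mp ipt}$ on $L^\pm$, where $c_1(L^\pm)=\pm n$. Pull $V$ back to $\mathbb{R}\times H^3$ and trivialise it so that $\mathbb{R}$ acts by translation only. Then invariant connections, invariant $\mathrm{End}(V)$-valued 1-forms, and invariant sections of $\mathrm{End}(V)$ or $\mathrm{Aut}(V)$ over $S^4\setminus S^2$ correspond to $\Phi\,d\theta+A$, to $\phi\,d\theta+a$, and to matrix-valued functions on $H^3$. Data on $H^3$ ''extends smoothly to $S^4$'' if the corresponding circle-invariant object extends smoothly over $S^2$. $C_{n,p}$ is the set of monopoles of charge $n$ and mass $p$ such that $\Phi\,d\theta+A$ extends smoothly to $V\to S^4$. Framed moduli space. $G^u$ is the group of $g:H^3\to SU(2)$ extending smoothly to circle-invariant sections of $\mathrm{Aut}(V)\to S^4$. For connections $A^0,A^1$, $CS[A^0,A^1]=\int_{[0,1]\times H^3}\mathrm{Tr}(F^{\tilde A}\wedge F^{\tilde A})$ with $\tilde A=(1-t)A^0+tA^1$. Two elements of $C_{n,p}$ are framed gauge equivalent if they are related by an element of $G^u$ and the number $CS$ of their connections is $0$. $M^f_{n,p}$ is the quotient of $C_{n,p}$ by framed gauge equivalence.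 For $x=[(A,\Phi)]$, $T_x^{\mathbb{C}}M^f_{n,p}$ is the space of $\mathfrak{sl}(2,\mathbb{C})$-valued pairs $(a,\phi)$ (1-form and function on $H^3$) with $d^A\phi+[a,\Phi]=*d^Aa$ and $\phi\,d\theta+a$ extending smoothly to $S^4$, modulo the pairs $(d^A\chi,[\Phi,\chi])$ with $\chi:H^3\to\mathfrak{sl}(2,\mathbb{C})$ extending smoothly to a circle-invariant section of $\mathrm{End}(V)\to S^4$ and $\int_{H^3}\mathrm{Tr}(F^A\wedge d^A\chi)=0$. The forms $g_\pm$. For each sign every $X\in T_x^{\mathbb{C}}M^f_{n,p}$ has a unique representative $(a_\pm,\phi_\pm)$ with $*d^A{*a_\pm}+[\Phi,\phi_\pm]\pm2i\phi_\pm=0$, and $g_\pm$ is the (convergent) complex symmetric bilinear form with $g_\pm(X,X)=-\frac12\int_{H^3}\mathrm{Tr}(a_\pm\wedge *a_\pm+\phi_\pm *\phi_\pm)$. Spinors. $S\to H^3$ is the rank 2 complex spinor bundle, with Clifford multiplication normalised so that $v\cdot v=-|v|^2$ and the volume form acts as the identity. $(\cdot,\cdot)$ is its parallel nondegenerate skew bilinear pairing (in a suitable local unitary frame $(s,t)=s_1t_2-s_2t_1$), with $(s,v\cdot t)=-(v\cdot s,t)$, and $s^*\in S^*$ is $s^*(t)=(s,t)$. The isomorphism $\mathrm{cl}_H:(\Lambda^1\oplus\Lambda^0)\otimes\mathbb{C}\to\mathrm{End}(S)\cong S\otimes S^*$ is $\mathrm{cl}_H(a,\phi)\psi=a\cdot\psi+\phi\psi$;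 it is extended to $\mathrm{End}_0(V)$-valued objects ($\mathrm{End}_0$ = traceless endomorphisms). $K^\pm$ is the (2-dimensional) space of sections $\psi$ of $S$ with $\nabla_X\psi=\pm\frac i2X\cdot\psi$ for all tangent vectors $X$. Eigenspinors. $D^A$ is the Dirac operator on $S\otimes\mathrm{End}_0(V)$ coupled to $A$. On $S^4$ the spinor bundle is $S_+\oplus S_-$, where self-dual 2-forms act by zero on $S_-$ and anti-self-dual ones by zero on $S_+$. Using the conformal identification (spinor bundles of conformal metrics being canonically identified), the pull-backs of $S_\pm$ to $\mathbb{R}\times H^3$ are identified with the pull-back of $S$ so that, for the metric $d\theta^2+g_{H^3}$, Clifford multiplication $S_+\to S_-$ by $d\theta$ is the identity and by $v\in\Lambda^1H^3$ is the Clifford multiplication of $S$. For $x=[(A,\Phi)]$, $E_x^\pm$ is the space of sections $\nu$ of $S\otimes\mathrm{End}_0(V)$ with $D^A\nu-[\Phi,\nu]=\pm\frac i2\nu$ such that $\tilde\nu:=r_1^{-3/2}e^{\pm i\theta/2}\nu$ extends to a smooth section of $S_-\otimes\mathrm{End}_0(V)$ over $S^4$. The map sending $\nu\otimes\psi$ to the class of $\mathrm{cl}_H^{-1}(\nu\otimes\psi^* )$ is an isomorphism $E_x^\pm\otimes K^\pm\cong T^{\mathbb{C}}_xM^f_{n,p}$. Skew forms and complex structures. $\omega_{E^\pm}(\nu_1,\nu_2)=-\frac12\int_{H^3}\mathrm{Tr}(\nu_1,\nu_2)\,\mathrm{Vol}_{H^3}$, where $(\nu_1,\nu_2)$ combines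 the pairing on $S$ with matrix multiplication in $\mathrm{End}(V)$. $\omega_{K^\pm}(\psi_1,\psi_2)$ is the value of the constant function $(\psi_1,\psi_2)$ on $H^3$. For nonzero $\psi\in K^+$, spanning the line $\langle\psi\rangle$, $J_{\langle\psi\rangle}$ is the almost complex structure on $M^f_{n,p}$ whose holomorphic tangent bundle ($+i$ eigenbundle in $T^{\mathbb{C}}M^f_{n,p}$) is $T^{1,0}_{\langle\psi\rangle}M^f_{n,p}=E^+\otimes\langle\psi\rangle$. *)

(* Defs.v *)
From HB Require Import structures.
From mathcomp Require Import all_boot all_order all_algebra ring.
From mathcomp Require Import all_classical all_reals all_analysis.
From mathcomp Require Import complex.

Set Implicit Arguments.
Unset Strict Implicit.
Unset Printing Implicit Defensive.

Import Order.TTheory GRing.Theory Num.Theory.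
Import numFieldNormedType.Exports.

Local Open Scope classical_set_scope.
Local Open Scope ring_scope.

(* H^3 is the open unit ball of R^3 (Poincare model) with its standard
   orientation, so that S^2_infty is the unit sphere oriented by the outward
   normal.  All geometric objects are functions on R^3 of which only the values
   on the ball matter.  One-forms and connections are given by their components
   in the coordinate coframe dx_1, dx_2, dx_3; spinors by their components in
   the frame of S attached to the orthonormal frame e_j = lam^-1 d/dx_j. *)

Section Defs.
Variable R : realType.

Local Notation C := (R[i]).
Local Notation I_ := (@Complex R 0 1).
Local Notation rc r := (@Complex R r 0).
Local Notation M2 := 'M[R[i]]_2.

Definition iter_partial k (s : seq 'I_k) (f : 'rV[R]_k -> R) : 'rV[R]_k -> R :=
  foldr (fun j g y => 'D_(delta_mx 0 j) g y) f s.

Definition smooth_on k (U : set 'rV[R]_k) (f : 'rV[R]_k -> R) : Prop :=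
  forall (s : seq 'I_k) (y : 'rV[R]_k), U y -> differentiable (iter_partial s f) y.

Definition msmooth_on k a b (U : set 'rV[R]_k) (F : 'rV[R]_k -> 'M[C]_(a, b)) : Prop :=
  forall i j, smooth_on U (fun y => complex.Re (F y i j)) /\
              smooth_on U (fun y => complex.Im (F y i j)).

Definition mderive k a b (v : 'rV[R]_k) (F : 'rV[R]_k -> 'M[C]_(a, b))
    (y : 'rV[R]_k) : 'M[C]_(a, b) :=
  \matrix_(i, j) Complex ('D_v (fun z => complex.Re (F z i j)) y)
                         ('D_v (fun z => complex.Im (F z i j)) y).

Definition mpartial k a b (j : 'I_k) (F : 'rV[R]_k -> 'M[C]_(a, b)) :
    'rV[R]_k -> 'M[C]_(a, b) :=
  mderive (delta_mx 0 j) F.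

Definition mcvg (T : Type) a b (F : T -> 'M[C]_(a, b)) (N : set_system T)
    (L : 'M[C]_(a, b)) : Prop :=
  forall i j, ((fun y => complex.Re (F y i j)) @ N --> complex.Re (L i j)) /\
              ((fun y => complex.Im (F y i j)) @ N --> complex.Im (L i j)).

Definition nsq k (x : 'rV[R]_k) : R := \sum_j x 0 j ^+ 2.

Definition H3 : set 'rV[R]_3 := [set x | nsq x < 1].

(* The metric is lam^2 |dx|^2. *)
Definition lam (x : 'rV[R]_3) : R := 2 / (1 - nsq x).

Definition mfield := 'rV[R]_3 -> M2.
Definition oneform := 'rV[R]_3 -> 'I_3 -> M2.
Definition hpair := (oneform * mfield)%type.

Definition point3 (t : R * R * R) : 'rV[R]_3 := \row_j [:: t.1.1; t.1.2; t.2]`_j.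

Local Notation mu1 := (@lebesgue_measure R).
Local Notation mu3 := ((mu1 \x mu1) \x mu1)%E.

(* The integral of the 3-form f dx_1 dx_2 dx_3 over the ball. *)
Definition int_coord (f : 'rV[R]_3 -> C) : C :=
  Complex (\int[mu3]_(t in [set t | H3 (point3 t)]) complex.Re (f (point3 t)))
          (\int[mu3]_(t in [set t | H3 (point3 t)]) complex.Im (f (point3 t))).

Definition int_vol (f : 'rV[R]_3 -> C) : C :=
  int_coord (fun x => rc (lam x ^+ 3) * f x).

Definition lie (X Y : M2) : M2 := X *m Y - Y *m X.

Definition covd (A : oneform) (f : mfield) : oneform :=
  fun x j => mpartial j f x + lie (A x j) (f x).

(* Indices in 'I_3 are added modulo 3, and a 2-form b on R^3 is stored as the
   triple (b_23, b_31, b_12), i.e. its j-th component is b (d_(j+1), d_(j+2)). *)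
Definition curv (A : oneform) : oneform := fun x j =>
  mpartial (j + 1) (fun y => A y (j + 2%:R)) x
  - mpartial (j + 2%:R) (fun y => A y (j + 1)) x
  + lie (A x (j + 1)) (A x (j + 2%:R)).

Definition covd1 (A a : oneform) : oneform := fun x j =>
  mpartial (j + 1) (fun y => a y (j + 2%:R)) x
  - mpartial (j + 2%:R) (fun y => a y (j + 1)) x
  + lie (A x (j + 1)) (a x (j + 2%:R)) - lie (A x (j + 2%:R)) (a x (j + 1)).

(* With the storage convention above, * : 2-forms -> 1-forms is lam^-1. *)
Definition star2 (b : oneform) : oneform := fun x j => rc (lam x)^-1 *: b x j.

(* * d^A * a, from * a = lam (a_1 dx_2 dx_3 + ...), * (dx_1 dx_2 dx_3) = lam^-3. *)
Definition codiff (A a : oneform) : mfield := fun x =>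
  rc (lam x ^- 3) *:
    \sum_j (mpartial j (fun y => rc (lam y) *: a y j) x
            + rc (lam x) *: lie (A x j) (a x j)).

(* int_(H^3) Tr (b /\ a), for a 2-form b and a 1-form a *)
Definition int_wedge (b a : oneform) : C :=
  int_coord (fun x => \sum_j \tr (b x j *m a x j)).

(* int_(H^3) Tr (a /\ * a' + phi * phi') *)
Definition int_star (p q : hpair) : C :=
  int_vol (fun x => \sum_j rc (lam x ^- 2) * \tr (p.1 x j *m q.1 x j)
                    + \tr (p.2 x *m q.2 x)).

Definition rad (x : 'rV[R]_3) : R := (1 - nsq x) / (1 + nsq x).

(* The identification of (theta, x) in S^1 * H^3 with a point of S^4 \ S^2;
   r_1 = rad x, and S^2_infty is mapped identically to S^2. *)
Definition Psi (th : R) (x : 'rV[R]_3) : 'rV[R]_(2 + 3) :=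
  row_mx (rad x *: \row_j [:: cos th; sin th]`_j) ((2 / (1 + nsq x)) *: x).

Definition S2 : set 'rV[R]_(2 + 3) :=
  [set y | lsubmx y = 0 /\ nsq (rsubmx y) = 1].

Variables n twop : nat.

Definition mass : R := twop%:R / 2.

(* sigma is homogeneous of degree 0, Hermitian, traceless, of square 1 on
   R^3 \ 0, and L^+ and L^- are its +1 and -1 eigenbundles on the unit sphere.
   In the coordinate z = (v_1 + i v_2) / (|v| + v_3), the line L^+ is spanned by
   (1, conj (z)^n), so that z |-> [1 : conj (z)^n] has degree -n; as the
   tautological bundle of CP^1 has degree -1, c_1 (L^+) = n and c_1 (L^-) = - n. *)
Definition sigma (v : 'rV[R]_3) : M2 :=
  let rho := Num.sqrt (nsq v) in
  let z := v 0 ord_max in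
  let w := Complex (v 0 0) (v 0 1) in
  let a := (rho + z) ^+ n in
  let b := (rho - z) ^+ n in
  \matrix_(i, j)
    (if i == 0 then (if j == 0 then rc ((a - b) / (a + b))
                     else rc (2 / (a + b)) * w ^+ n)
     else (if j == 0 then rc (2 / (a + b)) * (conjc w) ^+ n
           else rc ((b - a) / (a + b)))).

(* The bundle V over S^4.  Over the tubular neighbourhood {x <> 0} of S^2, V is
   the trivial bundle C^2, with t in the circle acting on it by exp (- i p t sigma).
   The trivialisation of the pull-back of V to R * H^3 in which R acts by
   translation is related to it by u (theta, x) = exp (- i p theta sigma (x)):
   s in the former is u s in the latter.  The R-equivariant bundle V
   is determined up to isomorphism by n and p. *)
Definition twist (th : R) (x : 'rV[R]_3) : M2 :=
  rc (cos (mass * th)) *: 1%:M - (I_ * rc (sin (mass * th))) *: sigma x.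

Definition conj_twist (th : R) (x : 'rV[R]_3) (X : M2) : M2 :=
  twist th x *m X *m twist (- th) x.

(* [G] is the expression, in the trivialisation of V near S^2, of an object
   defined on S^4 \ S^2. *)
Definition extends_over_S2 k (G : R -> 'rV[R]_3 -> 'I_k -> M2) : Prop :=
  exists U (F : 'rV[R]_(2 + 3) -> 'I_k -> M2),
    [/\ open U, S2 `<=` U, forall i, msmooth_on U (fun y => F y i)
      & forall th x i, H3 x -> x != 0 -> U (Psi th x) -> F (Psi th x) i = G th x i].

(* The same for the 1-form G0 dtheta + sum_j G j dx_j, which is required to be
   the restriction of a smooth 1-form sum_k F k dy_k. *)
Definition form_extends_over_S2 (G0 : R -> 'rV[R]_3 -> M2)
    (G : R -> 'rV[R]_3 -> 'I_3 -> M2) : Prop :=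
  exists U (F : 'rV[R]_(2 + 3) -> 'I_(2 + 3) -> M2),
    [/\ open U, S2 `<=` U, forall k, msmooth_on U (fun y => F y k)
      & forall th x, H3 x -> x != 0 -> U (Psi th x) ->
        G0 th x = \sum_k rc (derive1 (fun t => Psi t x 0 k) th) *: F (Psi th x) k /\
        forall j, G th x j =
          \sum_k rc ('D_(delta_mx 0 j) (fun z => Psi th z 0 k) x) *: F (Psi th x) k].

Definition section_extends (f : mfield) : Prop :=
  extends_over_S2 (fun th x (_ : 'I_1) => conj_twist th x (f x)).

(* phi dtheta + a, for an invariant End (V)-valued 1-form *)
Definition form_extends (p : hpair) : Prop :=
  form_extends_over_S2 (fun th x => conj_twist th x (p.2 x))
                       (fun th x j => conj_twist th x (p.1 x j)).

(* Phi dtheta + A, for an invariant connection: B becomes u B u^-1 - (d u) u^-1,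
   where (d u / d theta) u^-1 = - i p sigma. *)
Definition connection_extends (m : hpair) : Prop :=
  form_extends_over_S2
    (fun th x => conj_twist th x (m.2 x) + (I_ * rc mass) *: sigma x)
    (fun th x j => conj_twist th x (m.1 x j)
                   - mpartial j (twist th) x *m twist (- th) x).

Definition adj (X : M2) : M2 := (map_mx (@conjc R) X)^T.

Definition su2 (X : M2) : Prop := adj X = - X /\ \tr X = 0.
Definition SU2 (X : M2) : Prop := X *m adj X = 1%:M /\ \det X = 1.

Definition pair_smooth (p : hpair) : Prop :=
  (forall j, msmooth_on H3 (fun x => p.1 x j)) /\ msmooth_on H3 p.2.

Definition bogomolny (m : hpair) : Prop :=
  forall x j, H3 x -> covd m.1 m.2 x j = star2 (curv m.1) x j.

(* Phi has eigenvalue -/+ i p on L^+/-, and the restriction of A to the sphere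
   at infinity preserves L^+/-, i.e. it makes sigma covariantly constant. *)
Definition boundary_conditions (m : hpair) : Prop :=
  exists Ab : oneform, forall s, nsq s = 1 ->
    [/\ mcvg m.2 (within H3 (nbhs s)) (- (I_ * rc mass) *: sigma s),
        forall j, mcvg (fun x => m.1 x j) (within H3 (nbhs s)) (Ab s j)
      & forall v : 'rV[R]_3, \sum_j v 0 j * s 0 j = 0 ->
          mderive v sigma s + lie (\sum_j rc (v 0 j) *: Ab s j) (sigma s) = 0].

Definition monopole (m : hpair) : Prop :=
  [/\ pair_smooth m,
      forall x, H3 x -> (forall j, su2 (m.1 x j)) /\ su2 (m.2 x),
      bogomolny m & boundary_conditions m].

Definition Cnp : set hpair := [set m | monopole m /\ connection_extends m].

(* G^u *)
Definition gauge_group (g : mfield) : Prop :=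
  [/\ msmooth_on H3 g, forall x, H3 x -> SU2 (g x) & section_extends g].

Definition gauge_related (g : mfield) (m m' : hpair) : Prop :=
  forall x, H3 x ->
    (forall j, m'.1 x j = g x *m m.1 x j *m invmx (g x) - mpartial j g x *m invmx (g x))
    /\ m'.2 x = g x *m m.2 x *m invmx (g x).

(* With A^t = (1 - t) A0 + t A1, the curvature on [0, 1] * H^3 is
   dt /\ (A1 - A0) + F^(A^t), so that Tr (F /\ F) = 2 dt /\ Tr ((A1 - A0) /\ F^(A^t)). *)
Definition CS_density (A0 A1 : oneform) (t : R) (x : 'rV[R]_3) : C :=
  2 * \sum_j \tr ((A1 x j - A0 x j) *m
        curv (fun y k => rc (1 - t) *: A0 y k + rc t *: A1 y k) x j).

Definition CS (A0 A1 : oneform) : C :=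
  Complex (\int[mu1]_(t in `[0, 1]) complex.Re (int_coord (CS_density A0 A1 t)))
          (\int[mu1]_(t in `[0, 1]) complex.Im (int_coord (CS_density A0 A1 t))).

Definition framed_equiv (m m' : hpair) : Prop :=
  (exists2 g, gauge_group g & gauge_related g m m') /\ CS m.1 m'.1 = 0.

Definition framed_moduli : set (set hpair) :=
  [set x | exists2 m, Cnp m & x = [set m' | Cnp m' /\ framed_equiv m m']].

Section Tangent.
Variable m : hpair.
Local Notation A := m.1.
Local Notation Phi := m.2.

Definition tangent_pair (p : hpair) : Prop :=
  [/\ pair_smooth p,
      forall x, H3 x -> (forall j, \tr (p.1 x j) = 0) /\ \tr (p.2 x) = 0,
      forall x j, H3 x ->
        covd A p.2 x j + lie (p.1 x j) (Phi x) = star2 (covd1 A p.1) x j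
    & form_extends p].

Definition infinitesimal_gauge (chi : mfield) : Prop :=
  [/\ msmooth_on H3 chi, forall x, H3 x -> \tr (chi x) = 0, section_extends chi
    & int_wedge (curv A) (covd A chi) = 0].

(* The class of p in T_x; elements of T_x are such sets for p a tangent pair. *)
Definition tclass (p : hpair) : set hpair :=
  [set q | tangent_pair q /\
     exists2 chi, infinitesimal_gauge chi &
       forall x, H3 x -> (forall j, q.1 x j = p.1 x j + covd A chi x j)
                         /\ q.2 x = p.2 x + lie (Phi x) (chi x)].

Definition TC : set (set hpair) :=
  [set X | exists2 p, tangent_pair p & X = tclass p].

Definition padd (p q : hpair) : hpair :=
  (fun x j => p.1 x j + q.1 x j, fun x => p.2 x + q.2 x).
Definition pscale (c : C) (p : hpair) : hpair :=
  (fun x j => c *: p.1 x j, fun x => c *: p.2 x).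

(* The sign in g_+/-, E^+/- and K^+/- is + for [true] and - for [false]. *)
Definition pm (s : bool) : C := if s then 1 else -1.

Definition gauge_fixed (s : bool) (p : hpair) : Prop :=
  forall x, H3 x ->
    codiff A p.1 x + lie (Phi x) (p.2 x) + (pm s * 2 * I_) *: p.2 x = 0.

Definition symmetric_bilinear (g : set hpair -> set hpair -> C) : Prop :=
  (forall X Y, TC X -> TC Y -> g X Y = g Y X) /\
  (forall c p q Z, tangent_pair p -> tangent_pair q -> TC Z ->
     g (tclass (padd (pscale c p) q)) Z = c * g (tclass p) Z + g (tclass q) Z).

(* g is the form g_+/-: as each X in T_x has a unique representative satisfying
   [gauge_fixed s], its quadratic form, hence g on T_x, is determined. *)
Definition is_gform (s : bool) (g : set hpair -> set hpair -> C) : Prop :=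
  symmetric_bilinear g /\
  forall X p, TC X -> X p -> gauge_fixed s p -> g X X = - (1 / 2) * int_star p p.

Definition spinor := 'rV[R]_3 -> 'cV[C]_2.
(* sections of S (x) End_0 (V): the components in S are elements of End_0 (V) *)
Definition tspinor := 'rV[R]_3 -> 'I_2 -> M2.

(* Clifford multiplication by e_j, i times the j-th Pauli matrix, so that
   cliff_1 cliff_2 cliff_3 = 1. *)
Definition cliff (j : 'I_3) : M2 :=
  nth 0 [:: \matrix_(a, b) (if a == b then 0 else I_);
            \matrix_(a, b) (if a == b then 0 else if a == 0 then 1 else -1);
            \matrix_(a, b) (if a == b then (if a == 0 then I_ else - I_) else 0)] j.

(* g (nabla_(e_l) e_j, e_k) = x_j delta_kl - x_k delta_jl *)
Definition levi_civita (x : 'rV[R]_3) (l j k : 'I_3) : R :=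
  x 0 j * (k == l)%:R - x 0 k * (j == l)%:R.

Definition spin_conn (x : 'rV[R]_3) (l : 'I_3) : M2 :=
  (4%:R)^-1 *: \sum_j \sum_k rc (levi_civita x l j k) *: (cliff j *m cliff k).

(* nabla_(e_l) psi *)
Definition nabla (psi : spinor) (x : 'rV[R]_3) (l : 'I_3) : 'cV[C]_2 :=
  rc (lam x)^-1 *: mpartial l psi x + spin_conn x l *m psi x.

Definition pairing (s t : 'cV[C]_2) : C := s 0 0 * t 1 0 - s 1 0 * t 0 0.

(* K^+/- *)
Definition killing (s : bool) (psi : spinor) : Prop :=
  msmooth_on H3 psi /\
  forall x l, H3 x -> nabla psi x l = (pm s * I_ / 2) *: (cliff l *m psi x).

Definition omegaK (psi1 psi2 : spinor) : C := pairing (psi1 0) (psi2 0).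

Definition act_S k (X : 'M[C]_(k, 2)) (f : 'I_2 -> M2) : 'I_k -> M2 :=
  fun a => \sum_b X a b *: f b.

(* nabla^A_(e_l) nu *)
Definition tnabla (nu : tspinor) (x : 'rV[R]_3) (l : 'I_3) : 'I_2 -> M2 := fun a =>
  rc (lam x)^-1 *: (mpartial l (fun y => nu y a) x + lie (A x l) (nu x a))
  + act_S (spin_conn x l) (nu x) a.

Definition dirac (nu : tspinor) (x : 'rV[R]_3) : 'I_2 -> M2 := fun a =>
  \sum_l act_S (cliff l) (tnabla nu x l) a.

(* Spinors on S^4.  C^2 + C^2 is a Clifford module of R^5 with basis vectors
   acting by G1, G2, Gv 0, Gv 1, Gv 2.  The spinor bundle of S^4 is the trivial
   bundle C^2 + C^2 with the induced Clifford action of T S^4, S_+ and S_- at y being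
   the eigenspaces of y.  [spin_lift th x] covers minus the reflection of R^5 along
   w = (cos th, sin th, x), composed with the rotation by th: it conjugates G1 to
   the action of Psi th x, and G2, Gv j to minus the action of the unit vectors along
   d Psi / d theta, d Psi / d x_j.  It maps the reference eigenspaces 0 + C^2 and C^2 + 0
   of G1, on which G2 : C^2 + 0 -> 0 + C^2 is the identity and Gv j is cliff j, to S_-
   and S_+ at Psi th x, and so identifies (up to an irrelevant overall sign)
   the pull-backs of S_- and S_+ with that of S. *)
Definition G1 : 'M[C]_(2 + 2) := block_mx (I_ *: 1%:M) 0 0 (- I_ *: 1%:M).
Definition G2 : 'M[C]_(2 + 2) := block_mx 0 (- 1%:M) 1%:M 0.
Definition Gv (j : 'I_3) : 'M[C]_(2 + 2) := block_mx 0 (cliff j) (cliff j) 0.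

Definition spin_lift (th : R) (x : 'rV[R]_3) : 'M[C]_(2 + 2) :=
  rc (Num.sqrt (1 + nsq x))^-1 *:
    ((rc (cos (th / 2)) *: 1%:M + rc (sin (th / 2)) *: (G1 *m G2))
     *m (G1 + \sum_j rc (x 0 j) *: Gv j)).

Definition S_minus (th : R) (x : 'rV[R]_3) : 'M[C]_(2 + 2, 2) :=
  rsubmx (spin_lift th x).

(* r_1^(-3/2) e^(+/- i theta / 2) *)
Definition spin_weight (s : bool) (th : R) (x : 'rV[R]_3) : C :=
  rc (rad x `^ (- (3 / 2))) *
  Complex (cos (th / 2)) (if s then sin (th / 2) else - sin (th / 2)).

Definition spinor_extends (s : bool) (nu : tspinor) : Prop :=
  extends_over_S2 (fun th x (i : 'I_(2 + 2)) =>
    conj_twist th x (act_S (S_minus th x) (fun b => spin_weight s th x *: nu x b) i)).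

(* E_x^+/- *)
Definition eigenspinor (s : bool) (nu : tspinor) : Prop :=
  [/\ forall a, msmooth_on H3 (fun x => nu x a),
      forall x a, H3 x -> \tr (nu x a) = 0,
      forall x a, H3 x ->
        dirac nu x a - lie (Phi x) (nu x a) = (pm s * I_ / 2) *: nu x a
    & spinor_extends s nu].

Definition omegaE (nu1 nu2 : tspinor) : C :=
  - (1 / 2) * int_vol (fun x => \tr (nu1 x 0 *m nu2 x 1 - nu1 x 1 *m nu2 x 0)).

(* sections of End (S) (x) End_0 (V) *)
Definition endo := 'rV[R]_3 -> 'I_2 -> 'I_2 -> M2.

(* lam^-1 p.1 x j is the value on e_j of the 1-form *)
Definition clH (p : hpair) : endo := fun x a b =>
  \sum_j (rc (lam x)^-1 * cliff j a b) *: p.1 x j + (a == b)%:R *: p.2 x.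

Definition clH_inv (N : endo) : hpair :=
  (fun x j => - (rc (lam x) / 2) *: \sum_a \sum_b cliff j a b *: N x b a,
   fun x => (1 / 2) *: \sum_a N x a a).

Lemma clH_invK (N : endo) x a b : H3 x -> clH (clH_inv N) x a b = N x a b.
Proof.
rewrite /H3 /= => Hx.
have l0 : Complex (lam x) 0 != 0.
  apply/eqP => -[]; apply/eqP; rewrite mulf_neq0 ?invr_eq0 ?subr_eq0 ?pnatr_eq0//.
  by rewrite eq_sym lt_eqF.
have lE : Complex (lam x)^-1 0 = (Complex (lam x) 0)^-1.
  by rewrite -(fmorphV (real_complex R)).
have ii : (Complex 0 1 : R[i]) * Complex 0 1 = -1.
  by apply/eqP; rewrite eq_complex /= !(mul0r,mulr0,mulr1,add0r,sub0r,oppr0,addr0) !eqxx.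
rewrite /clH /clH_inv /cliff lE; set l := Complex (lam x) 0 in l0 *.
set I_ := Complex 0 1 in ii *.
apply/matrixP => i j.
rewrite !(big_ord_recl, big_ord0) /= !mxE !(big_ord_recl, big_ord0, mxE) /=.
have ord2 (c : 'I_2) : c = ord0 \/ c = lift ord0 ord0.
  by case: c => -[|[|//]] ?; [left|right]; apply/val_inj.
have two0 : (2 : R[i]) != 0 by rewrite pnatr_eq0.
case: (ord2 a) => ->; case: (ord2 b) => -> /=; rewrite ?(big_ord_recl, big_ord0, mxE) /=.
all: rewrite -/l -/I_.
all: have E (c S : R[i]) : l^-1 * c * (- (l / 2) * S) = - (c * S / 2) by field; rewrite l0.
all: by rewrite !E; field: ii.
Qed.

(* nu (x) psi^*, where psi^* (t) = psi_1 t_2 - psi_2 t_1 *)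
Definition tensor (nu : tspinor) (psi : spinor) : endo := fun x a b =>
  (if b == 0 then - psi x 1 0 else psi x 0 0) *: nu x a.

Definition EK (nu : tspinor) (psi : spinor) : set hpair :=
  tclass (clH_inv (tensor nu psi)).

(* The image of E^+ (x) <psi>; every element of E^+ (x) <psi> is some nu (x) psi. *)
Definition T10 (psi : spinor) : set (set hpair) :=
  [set X | exists2 nu, eigenspinor true nu & X = EK nu psi].

End Tangent.
End Defs.

(* Main.v *)
From HB Require Import structures.
Require Import Defs.
From mathcomp Require Import all_boot all_order all_algebra ring.
From mathcomp Require Import all_classical all_reals all_analysis.
From mathcomp Require Import complex.

Import Order.TTheory GRing.Theory Num.Theory.
Import numFieldNormedType.Exports.
Local Open Scope classical_set_scope.
Local Open Scope ring_scope.

Set Implicit Arguments.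
Unset Strict Implicit.
Unset Printing Implicit Defensive.

(** Let nu be in E^s and psi in K^s, where s is a sign, and let p = (a, phi) be the pair
    [clH_inv (tensor nu psi)] whose class is the image of nu (x) psi.

    This pair is itself the representative that computes g_s.  Up to scalars a_j and phi are
    the contractions (psi, c_j nu) and (psi, nu), where c_j is Clifford multiplication.  The
    covariant derivative of psi is prescribed by the Killing equation, and the commutator
    of the Higgs field with nu is expressed by the Dirac equation through derivatives of nu.
    After these substitutions the linearised Bogomolny equation and the gauge condition are
    equations between terms (psi, M nu) and (psi, M nabla_l nu) with M in the Clifford
    algebra.  The coefficients M agree, by the relations between the c_j
    ([linearised_bogomolny], [gauge_fixed_clH]).

    The pair extends over the sphere at infinity because Killing spinors come from S^4.
    Integrating the Killing equation gives
      psi(x) = (1 - |x|^2)^(-1/2) (1 + e x.) psi(0),     e = +/- i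
    ([killing_formula]), x. being Clifford multiplication by the position vector.  Up to the
    conformal weight and the frame of S_+, this is the restriction to S^4 of a spinor that
    is affine in the coordinates of R^5, a twistor spinor.  Pairing it with the Clifford
    products of dy_k and the extension of nu gives smooth functions on R^5.  They are the
    coefficients of a 1-form, and its pull-back is phi dtheta + a ([extension_dtheta],
    [extension_dx]).

    Hence g_s is minus one half of the integral of the density <p, q> on such pairs and on
    their sums.  The Fierz identity ([fierz_contract]) evaluates the density pointwise: for
    p1, p2 coming from nu1 (x) psi1 and nu2 (x) psi2 it is
      1/2 (psi1, psi2) Tr (nu1, nu2),
    where (psi1, psi2) is constant ([killing_pairing]).  It vanishes for psi1 = psi2, so that
    the classes of decomposable elements are null vectors of g_s; for s = + this is the
    compatibility with the complex structures.  It also leaves only the cross term when g_s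
    is evaluated on c X1 + X2 ([gform_polar]).  If (psi1, psi2) <> 0, the choice
    c = (psi1, psi2)^-1 makes the integrand equal to the one that defines omega_E, and the
    formula for g_s (X1, X2) follows by bilinearity.  If (psi1, psi2) = 0, the integrand is zero. *)

(** * Functions smooth on an open set *)

Lemma near_eq_on (T : topologicalType) (W : Type) (U : set T)
  (f g : T -> W) y : open U -> U y -> {in U, f =1 g} -> \near y, f y = g y.
Proof.
move=> oU Uy fg; have := open_nbhs_nbhs (conj oU Uy).
by apply: filterS => z Uz; apply: fg; rewrite inE.
Qed.

(** Differentiability is a local property: both functions have the same first order expansion. *)
Lemma differentiable_eq_on (R : realType) (V W : normedModType R) (U : set V)
  (f g : V -> W) y : open U -> U y -> {in U, f =1 g} ->
  differentiable f y -> differentiable g y.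
Proof.
move=> oU Uy fg dfy; have [cf ef] := (diff_locallyP _ _).1 dfy.
have eg : g \o shift y = cst (g y) + 'd f y +o_ 0 id.
  apply/eqaddoP => e e0; move/eqaddoP: ef => /(_ e e0).
  have : \forall h \near (0 : V), U (h + y).
    have := open_nbhs_nbhs (conj oU Uy); rewrite -[nbhs _ _]/(\near y, U y).
    by rewrite (near_shift 0 y)/= subr0.
  by apply: filterS2 => h Uhy; rewrite !fctE/= /shift/= !fg// inE.
have gf := diff_unique cf eg.
by apply/diff_locallyP; split; rewrite gf.
Qed.

Section Smooth.
Variables (R : realType) (k : nat).
Local Notation V := 'rV[R]_k.
Implicit Types (f g : V -> R) (U : set V).

Lemma iter_partial_rcons (s : seq 'I_k) (j : 'I_k) f :
  iter_partial (rcons s j) f = iter_partial s ('D_(delta_mx 0 j) f).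
Proof. by rewrite /iter_partial foldr_rcons. Qed.

Lemma iter_partial_eq_on U (s : seq 'I_k) f g : open U -> {in U, f =1 g} ->
  {in U, iter_partial s f =1 iter_partial s g}.
Proof.
move=> oU fg; elim: s => [//|j s IH] y /[!inE] Uy /=.
exact: near_eq_derive (near_eq_on oU Uy IH).
Qed.

(** Smoothness is defined through all iterated partial derivatives, which makes products and
    inverses awkward.  The present class is stable under a single partial derivative, so an
    induction on the number of derivatives shows that its members are smooth. *)
Inductive smooth_alg U : (V -> R) -> Prop :=
  | smooth_alg_base f : smooth_on U f -> smooth_alg U f
  | smooth_alg_cst a : smooth_alg U (fun=> a)
  | smooth_alg_coord j : smooth_alg U (fun y => y 0 j)
  | smooth_alg_add f g : smooth_alg U f -> smooth_alg U g ->
      smooth_alg U (fun y => f y + g y)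
  | smooth_alg_mul f g : smooth_alg U f -> smooth_alg U g ->
      smooth_alg U (fun y => f y * g y)
  | smooth_alg_inv f : (forall y, U y -> f y != 0) -> smooth_alg U f ->
      smooth_alg U (fun y => (f y)^-1).

Lemma derive_coord (i j : 'I_k) (y : V) :
  'D_(delta_mx 0 j) (fun z : V => z 0 i) y = (i == j)%:R.
Proof.
pose f := fun z : V => z 0 i.
have lf : linear f by move=> a u v; rewrite /f !mxE.
pose L : {linear V -> R} := HB.pack f (GRing.isLinear.Build _ _ _ _ f lf).
have cL : continuous L by exact: coord_continuous.
rewrite deriveE; last exact: differentiable_coord.
by rewrite -[X in 'd X _]/(L : _ -> _) diff_lin// /L/= /f !mxE eqxx.
Qed.

Lemma smooth_alg_diff U f : smooth_alg U f -> forall y, U y -> differentiable f y.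
Proof.
elim=> {f} [f sf|a|j|f g _ df _ dg|f g _ df _ dg|f f0 _ df] y Uy.
- exact: (sf [::]).
- exact: differentiable_cst.
- exact: differentiable_coord.
- by apply: differentiableD; [apply: df|apply: dg].
- by apply: differentiableM; [apply: df|apply: dg].
- by apply: differentiableV; [apply: df|apply: f0].
Qed.

(** The derivative of an inverse involves the inverse again, hence the closure under products
    and inverses together. *)
Lemma smooth_alg_partial U f (j : 'I_k) : smooth_alg U f ->
  exists2 g, smooth_alg U g & {in U, 'D_(delta_mx 0 j) f =1 g}.
Proof.
have dv h y : smooth_alg U h -> U y -> derivable h y (delta_mx 0 j).
  by move=> sh Uy; apply: diff_derivable; apply: smooth_alg_diff sh _ Uy.
elim=> {f} [f sf|a|i|f g sf [f' sf' ff'] sg [g' sg' gg']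
  |f g sf [f' sf' ff'] sg [g' sg' gg']|f f0 sf [f' sf' ff']].
- exists ('D_(delta_mx 0 j) f) => //; apply: smooth_alg_base => s y Uy.
  by rewrite -iter_partial_rcons; apply: sf.
- by exists (fun=> 0); [apply: smooth_alg_cst|move=> y _; rewrite derive_cst].
- by exists (fun=> (i == j)%:R); [apply: smooth_alg_cst|move=> y _; rewrite derive_coord].
- exists (fun y => f' y + g' y); first exact: smooth_alg_add.
  move=> y Uy; rewrite -ff'// -gg'// -deriveD//; apply: dv => //; exact: set_mem.
- exists (fun y => f y * g' y + g y * f' y).
    by apply: smooth_alg_add; apply: smooth_alg_mul.
  move=> y Uy; rewrite -ff'// -gg'// -[RHS]deriveM//; apply: dv => //; exact: set_mem.
- exists (fun y => (-1) * ((f y)^-1 * (f y)^-1 * f' y)).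
    apply: smooth_alg_mul; first exact: smooth_alg_cst.
    by do 2 ![apply: smooth_alg_mul => //]; apply: smooth_alg_inv.
  move=> y /[dup] Uy /set_mem Uy'; rewrite -ff'// deriveV ?f0//; last exact: dv.
  by rewrite /GRing.scale/= mulN1r mulNr expr2 invfM.
Qed.

Lemma smooth_algP U f : open U -> smooth_alg U f -> smooth_on U f.
Proof.
move=> oU sf s; elim/last_ind: s f sf => [|s j IH] f sf y Uy.
  exact: smooth_alg_diff sf _ Uy.
rewrite iter_partial_rcons; have [g sg fg] := smooth_alg_partial j sf.
apply: (@differentiable_eq_on _ _ _ U (iter_partial s g)) => //; last exact: IH.
by move=> z Uz; rewrite (iter_partial_eq_on s oU fg).
Qed.
End Smooth.

(** * Partial derivatives of complex and matrix functions *)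

Section DirectionalDerivatives.
Variables (R : realType) (k : nat).
Local Notation V := 'rV[R]_k.
Local Notation C := R[i].
Local Notation rc r := (@Complex R r 0).
Implicit Types (x v : V).

Definition has_partial v (f : V -> R) x (d : R) : Prop :=
  differentiable f x /\ 'D_v f x = d.

Lemma has_partial_cst v x (a : R) : has_partial v (fun=> a) x 0.
Proof. by split; [apply: differentiable_cst|rewrite derive_cst]. Qed.

Lemma has_partial_coord (j i : 'I_k) x :
  has_partial (delta_mx 0 j) (fun z => z 0 i) x (i == j)%:R.
Proof. by split; [apply: differentiable_coord|rewrite derive_coord]. Qed.

Lemma has_partialD v x f g a b : has_partial v f x a -> has_partial v g x b ->
  has_partial v (fun z => f z + g z) x (a + b).
Proof.
move=> [df <-] [dg <-]; split; first exact: differentiableD.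
by rewrite -deriveD//; apply: diff_derivable.
Qed.

Lemma has_partialM v x f g a b : has_partial v f x a -> has_partial v g x b ->
  has_partial v (fun z => f z * g z) x (f x * b + g x * a).
Proof.
move=> [df <-] [dg <-]; split; first exact: differentiableM.
by rewrite -[RHS]deriveM//; apply: diff_derivable.
Qed.

Lemma has_partialV v x f a : f x != 0 -> has_partial v f x a ->
  has_partial v (fun z => (f z)^-1) x (- (f x) ^- 2 * a).
Proof.
move=> f0 [df <-]; split; first exact: differentiableV.
by rewrite deriveV//; apply: diff_derivable.
Qed.

Lemma has_partial_comp v x (f : V -> R) a (h : R -> R) b : is_derive (f x) 1 h b ->
  has_partial v f x a -> has_partial v (fun z => h (f z)) x (b * a).
Proof.
move=> [dh hb] [df <-]; have dh' : differentiable h (f x) by apply/derivable1_diffP.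
have dhf : differentiable (fun z => h (f z)) x.
  exact: (@differentiable_comp _ _ _ _ f h).
split=> //; rewrite !deriveE//.
rewrite -[X in 'd X x]/(h \o f) (@diff_comp _ _ _ _ f h)//= -hb.
by rewrite deriveE// -[in LHS](mulr1 ('d f x v)) [_ * 1]/(_ *: _) linearZ/= mulrC.
Qed.

Lemma has_partial_sum v x n (f : 'I_n -> V -> R) (a : 'I_n -> R) :
  (forall i, has_partial v (f i) x (a i)) ->
  has_partial v (fun z => \sum_i f i z) x (\sum_i a i).
Proof.
elim: n f a => [|n IH] f a H.
  rewrite big_ord0 (_ : (fun _ => _) = fun=> 0); first exact: has_partial_cst.
  by apply/funext => z; rewrite big_ord0.
rewrite big_ord_recl (_ : (fun _ => _) = fun z => f ord0 z + \sum_i f (lift ord0 i) z).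
  by apply: has_partialD => //; apply: IH.
by apply/funext => z; rewrite big_ord_recl.
Qed.

Definition has_cpartial v (f : V -> C) x (d : C) : Prop :=
  has_partial v (fun z => complex.Re (f z)) x (complex.Re d) /\
  has_partial v (fun z => complex.Im (f z)) x (complex.Im d).

Lemma has_cpartial_cst v x (a : C) : has_cpartial v (fun=> a) x 0.
Proof. by split; apply: has_partial_cst. Qed.

Lemma has_cpartial_rc v x f a : has_partial v f x a ->
  has_cpartial v (fun z => rc (f z)) x (rc a).
Proof. by split=> //; apply: has_partial_cst. Qed.

Lemma has_cpartialD v x f g a b : has_cpartial v f x a -> has_cpartial v g x b ->
  has_cpartial v (fun z => f z + g z) x (a + b).
Proof.
move=> [fr fi] [gr gi]; split.
  have := has_partialD fr gr; congr has_partial; last by case: a b {fr fi gr gi} => ? ? [].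
  by apply/funext => z; case: (f z) (g z) => ? ? [].
have := has_partialD fi gi; congr has_partial; last by case: a b {fr fi gr gi} => ? ? [].
by apply/funext => z; case: (f z) (g z) => ? ? [].
Qed.

Lemma has_partial_eq v x f g a b : has_partial v f x a -> f =1 g -> a = b ->
  has_partial v g x b.
Proof. by move=> ? /funext <- <-. Qed.

Lemma has_cpartialM v x f g a b : has_cpartial v f x a -> has_cpartial v g x b ->
  has_cpartial v (fun z => f z * g z) x (f x * b + g x * a).
Proof.
move=> [fr fi] [gr gi]; split.
  apply: (has_partial_eq (has_partialD (has_partialM fr gr)
    (has_partialM (has_partial_cst v x (-1)) (has_partialM fi gi)))).
    by move=> z; case: (f z) (g z) => ? ? [] ? ? /=; ring.
  by case: (f x) (g x) a b {fr fi gr gi} => ? ? [] ? ? [] ? ? [] ? ? /=; ring.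
apply: (has_partial_eq (has_partialD (has_partialM fr gi) (has_partialM fi gr))).
  by move=> z; case: (f z) (g z) => ? ? [] ? ? /=; ring.
by case: (f x) (g x) a b {fr fi gr gi} => ? ? [] ? ? [] ? ? [] ? ? /=; ring.
Qed.

Lemma has_cpartial_sum v x n (f : 'I_n -> V -> C) (a : 'I_n -> C) :
  (forall i, has_cpartial v (f i) x (a i)) ->
  has_cpartial v (fun z => \sum_i f i z) x (\sum_i a i).
Proof.
elim: n f a => [|n IH] f a H.
  rewrite big_ord0 (_ : (fun _ => _) = fun=> 0); first exact: has_cpartial_cst.
  by apply/funext => z; rewrite big_ord0.
rewrite big_ord_recl (_ : (fun _ => _) = fun z => f ord0 z + \sum_i f (lift ord0 i) z).
  by apply: has_cpartialD => //; apply: IH.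
by apply/funext => z; rewrite big_ord_recl.
Qed.

Lemma mpartial_entry a b (j : 'I_k) (F : V -> 'M[C]_(a, b)) x p q d :
  has_cpartial (delta_mx 0 j) (fun z => F z p q) x d -> mpartial j F x p q = d.
Proof. by move=> [[_ e1] [_ e2]]; rewrite mxE e1 e2; case: d {e1 e2}. Qed.

Definition csmooth (U : set V) (f : V -> C) : Prop :=
  smooth_on U (fun y => complex.Re (f y)) /\ smooth_on U (fun y => complex.Im (f y)).

Lemma csmooth_has_cpartial a b U (F : V -> 'M[C]_(a, b)) x p q (j : 'I_k) :
  csmooth U (fun y => F y p q) -> U x ->
  has_cpartial (delta_mx 0 j) (fun z => F z p q) x (mpartial j F x p q).
Proof.
move=> [sr si] Ux; rewrite mxE; split; split=> //; [exact: (sr [::])|exact: (si [::])].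
Qed.

Lemma smooth_alg_sum (U : set V) n (f : 'I_n -> V -> R) :
  (forall i, smooth_alg U (f i)) -> smooth_alg U (fun y => \sum_i f i y).
Proof.
elim: n f => [|n IH] f H.
  rewrite (_ : (fun _ => _) = fun=> 0); first exact: smooth_alg_cst.
  by apply/funext => z; rewrite big_ord0.
rewrite (_ : (fun _ => _) = fun z => f ord0 z + \sum_i f (lift ord0 i) z).
  by apply: smooth_alg_add => //; apply: IH.
by apply/funext => z; rewrite big_ord_recl.
Qed.

Section Closure.
Variable U : set V.
Hypothesis oU : open U.

Lemma csmooth_rc f : smooth_alg U f -> csmooth U (fun y => rc (f y)).
Proof. by move=> sf; split; apply: smooth_algP => //; apply: smooth_alg_cst. Qed.

Lemma csmooth_cst a : csmooth U (fun=> a).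
Proof. by split; apply: smooth_algP => //; apply: smooth_alg_cst. Qed.

Lemma csmoothD f g : csmooth U f -> csmooth U g -> csmooth U (fun y => f y + g y).
Proof.
move=> [fr fi] [gr gi]; split; apply: smooth_algP => //.
  rewrite (_ : (fun _ => _) = fun y => complex.Re (f y) + complex.Re (g y)).
    by apply: smooth_alg_add; apply: smooth_alg_base.
  by apply/funext => y; case: (f y) (g y) => ? ? [].
rewrite (_ : (fun _ => _) = fun y => complex.Im (f y) + complex.Im (g y)).
  by apply: smooth_alg_add; apply: smooth_alg_base.
by apply/funext => y; case: (f y) (g y) => ? ? [].
Qed.

Lemma csmoothM f g : csmooth U f -> csmooth U g -> csmooth U (fun y => f y * g y).
Proof.
move=> [fr fi] [gr gi].
have [ar ai br bi] : [/\ smooth_alg U (fun y => complex.Re (f y)),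
    smooth_alg U (fun y => complex.Im (f y)),
    smooth_alg U (fun y => complex.Re (g y)) & smooth_alg U (fun y => complex.Im (g y))].
  by split; apply: smooth_alg_base.
split; apply: smooth_algP => //.
  rewrite (_ : (fun _ => _) = fun y => complex.Re (f y) * complex.Re (g y)
      + (-1) * (complex.Im (f y) * complex.Im (g y))).
    apply: smooth_alg_add; first exact: smooth_alg_mul.
    by apply: smooth_alg_mul; [apply: smooth_alg_cst|apply: smooth_alg_mul].
  by apply/funext => y; case: (f y) (g y) => ? ? [] ? ? /=; ring.
rewrite (_ : (fun _ => _) = fun y => complex.Re (f y) * complex.Im (g y)
    + complex.Im (f y) * complex.Re (g y)).
  by apply: smooth_alg_add; apply: smooth_alg_mul.
by apply/funext => y; case: (f y) (g y) => ? ? [] ? ? /=; ring.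
Qed.

Lemma csmooth_sum n (f : 'I_n -> V -> C) :
  (forall i, csmooth U (f i)) -> csmooth U (fun y => \sum_i f i y).
Proof.
elim: n f => [|n IH] f H.
  rewrite (_ : (fun _ => _) = fun=> 0); first exact: csmooth_cst.
  by apply/funext => z; rewrite big_ord0.
rewrite (_ : (fun _ => _) = fun z => f ord0 z + \sum_i f (lift ord0 i) z).
  by apply: csmoothD => //; apply: IH.
by apply/funext => z; rewrite big_ord_recl.
Qed.

Lemma msmooth_onD a b (F G : V -> 'M[C]_(a, b)) :
  msmooth_on U F -> msmooth_on U G -> msmooth_on U (fun y => F y + G y).
Proof.
move=> sF sG i j.
rewrite -/(csmooth U (fun y => (F y + G y) i j)).
rewrite (_ : (fun y => (F y + G y) i j) = fun y => F y i j + G y i j).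
  by apply: csmoothD; [apply: sF|apply: sG].
by apply/funext => y; rewrite mxE.
Qed.

Lemma msmooth_onZ a b (c : V -> C) (F : V -> 'M[C]_(a, b)) :
  csmooth U c -> msmooth_on U F -> msmooth_on U (fun y => c y *: F y).
Proof.
move=> sc sF i j; rewrite -/(csmooth U (fun y => (c y *: F y) i j)).
rewrite (_ : (fun y => (c y *: F y) i j) = fun y => c y * F y i j).
  by apply: csmoothM => //; apply: sF.
by apply/funext => y; rewrite mxE.
Qed.

Lemma msmooth_on_sum a b n (F : 'I_n -> V -> 'M[C]_(a, b)) :
  (forall i, msmooth_on U (F i)) -> msmooth_on U (fun y => \sum_i F i y).
Proof.
move=> sF p q; rewrite -/(csmooth U (fun y => (\sum_i F i y) p q)).
rewrite (_ : (fun y => _) = fun y => \sum_i F i y p q).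
  by apply: csmooth_sum => i; apply: sF.
by apply/funext => y; rewrite summxE.
Qed.
End Closure.
End DirectionalDerivatives.

(** * Calculus on the ball model *)

Section Ball.
Variable R : realType.
Implicit Types x : 'rV[R]_3.
Local Notation e_ j := (delta_mx 0 j : 'rV[R]_3).

Lemma has_partial_nsq (j : 'I_3) x : has_partial (e_ j) (@nsq R 3) x (2 * x 0 j).
Proof.
apply: (has_partial_eq (has_partial_sum
  (fun i => has_partialM (has_partial_coord j i x) (has_partial_coord j i x)))).
  by move=> z; apply: eq_bigr => i _; rewrite expr2.
rewrite (bigD1 j)//= big1 => [|i /negPf ->]; last by rewrite !mulr0 addr0.
by rewrite eqxx !mulr1 addr0 -mulr2n mulr_natl.
Qed.

Lemma smooth_nsq k (U : set 'rV[R]_k) : smooth_alg U (@nsq R k).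
Proof.
rewrite (_ : @nsq R k = fun z => \sum_j z 0 j * z 0 j).
  by apply: smooth_alg_sum => j; apply: smooth_alg_mul; apply: smooth_alg_coord.
by apply/funext => z; apply: eq_bigr => j _; rewrite expr2.
Qed.

Lemma H3_open : open (@H3 R).
Proof.
rewrite (_ : @H3 R = @nsq R 3 @^-1` [set r | r < 1]).
  apply: open_comp; last exact: open_lt.
  by move=> x _; apply: differentiable_continuous; have [] := has_partial_nsq 0 x.
by [].
Qed.

Lemma H3_gt0 x : H3 x -> 0 < 1 - nsq x. Proof. by rewrite subr_gt0. Qed.

Lemma nsq_ge0 k (x : 'rV[R]_k) : 0 <= nsq x.
Proof. by apply: sumr_ge0 => i _; apply: sqr_ge0. Qed.

Lemma has_partial_subnsq (j : 'I_3) x :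
  has_partial (e_ j) (fun z => 1 - nsq z) x (- (2 * x 0 j)).
Proof.
have h := has_partialM (has_partial_cst (e_ j) x (-1)) (has_partial_nsq j x).
apply: (has_partial_eq (has_partialD (has_partial_cst (e_ j) x 1) h)); last by ring.
by move=> z; rewrite mulN1r.
Qed.

Lemma has_partial_lam (j : 'I_3) x : H3 x ->
  has_partial (e_ j) (@lam R) x (lam x ^+ 2 * x 0 j).
Proof.
move=> /H3_gt0 /lt0r_neq0 h0.
apply: (has_partial_eq (has_partialM (has_partial_cst (e_ j) x 2)
  (has_partialV h0 (has_partial_subnsq j x)))) => //.
by rewrite /lam; field.
Qed.

Lemma smooth_sub_nsq U : smooth_alg U (fun x : 'rV[R]_3 => 1 - nsq x : R).
Proof.
rewrite (_ : (fun x : 'rV[R]_3 => _) = fun x => 1 + (-1) * nsq x); last first.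
  by apply/funext => x; rewrite mulN1r.
exact: (smooth_alg_add (smooth_alg_cst _ 1)
  (smooth_alg_mul (smooth_alg_cst _ (-1)) (smooth_nsq _))).
Qed.

Lemma smooth_lam : smooth_alg (@H3 R) (@lam R).
Proof.
have inv : smooth_alg (@H3 R) (fun x => (1 - nsq x)^-1).
  by apply: smooth_alg_inv => [y /H3_gt0 /lt0r_neq0//|]; apply: smooth_sub_nsq.
exact: (smooth_alg_mul (smooth_alg_cst _ 2) inv).
Qed.

(** The ball is star-shaped about 0, so the mean value theorem applies to t |-> f (t x). *)
Lemma ball_cst (f : 'rV[R]_3 -> R) :
  (forall x (j : 'I_3), H3 x -> has_partial (e_ j) f x 0) ->
  forall x, H3 x -> f x = f 0.
Proof.
move=> f0 x Hx.
have dfx z : H3 z -> differentiable f z by move=> /(f0 z 0) [].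
have dz z : H3 z -> 'd f z x = 0.
  move=> Hz; rewrite [x in 'd f z x]row_sum_delta linear_sum big1// => j _.
  have dj : 'd f z (e_ j) = 0.
    by rewrite -deriveE; [exact: (proj2 (f0 z j Hz))|exact: dfx].
  by rewrite linearZ/= dj scaler0.
have Hseg t : 0 <= t <= 1 -> H3 (t *: x).
  move=> /andP[t0 t1]; rewrite /H3/=; apply: le_lt_trans Hx.
  apply: ler_sum => i _; rewrite mxE exprMn ler_piMl ?sqr_ge0//.
  by rewrite expr_le1.
have dsc (t : R) : differentiable (fun t : R => t *: x) t by [].
have dg (t : R) : 0 <= t <= 1 -> is_derive t 1 (fun t : R => f (t *: x)) 0.
  move=> /Hseg Ht; have dft := dfx _ Ht.
  have dc : differentiable (fun t : R => f (t *: x)) t.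
    exact: (@differentiable_comp _ _ _ _ (fun t : R => t *: x) f).
  split; first exact/derivable1_diffP.
  rewrite deriveE// -[X in 'd X t]/(f \o (fun t : R => t *: x)).
  rewrite (@diff_comp _ _ _ _ (fun t : R => t *: x) f)//= diff_val/=.
  by rewrite scale1r dz.
have dgo (t : R) : t \in `]0, 1[ -> is_derive t 1 (fun t : R => f (t *: x)) 0.
  by rewrite in_itv/= => /andP[t0 t1]; apply: dg; rewrite (ltW t0) (ltW t1).
have cg : {within `[0, 1], continuous (fun t : R => f (t *: x))}.
  apply: derivable_within_continuous => t; rewrite in_itv/= => t01.
  by have [] := dg t t01.
have [c _] := MVT_segment ler01 dgo cg.
by rewrite mul0r scale1r scale0r => /subr0_eq.
Qed.
End Ball.

(** * The Clifford algebra of three-space *)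

Section Clifford.
Variable R : realType.
Implicit Types x : 'rV[R]_3.
Local Notation C := R[i].
Local Notation I_ := (@Complex R 0 1).
Local Notation rc r := (@Complex R r 0).
Local Notation e_ j := (delta_mx 0 j : 'rV[R]_3).

Lemma ord2_ind (P : 'I_2 -> Prop) : P 0 -> P 1 -> forall i, P i.
Proof.
move=> P0 P1 [[|[|//]] i2].
  by rewrite (_ : Ordinal i2 = 0) //; apply/val_inj.
by rewrite (_ : Ordinal i2 = 1) //; apply/val_inj.
Qed.

Lemma ord3_ind (P : 'I_3 -> Prop) : P 0 -> P 1 -> P 2%:R -> forall i, P i.
Proof.
move=> P0 P1 P2 [[|[|[|//]]] i3].
- by rewrite (_ : Ordinal i3 = 0) //; apply/val_inj.
- by rewrite (_ : Ordinal i3 = 1) //; apply/val_inj.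
- by rewrite (_ : Ordinal i3 = 2%:R) //; apply/val_inj.
Qed.

Lemma sum2E (V : nmodType) (F : 'I_2 -> V) : \sum_i F i = F 0 + F 1.
Proof.
rewrite !big_ord_recl big_ord0 addr0.
by rewrite (_ : lift _ _ = 1); last exact/val_inj.
Qed.

Lemma sum3E (V : nmodType) (F : 'I_3 -> V) : \sum_i F i = F 0 + F 1 + F 2%:R.
Proof.
rewrite !big_ord_recl big_ord0 addr0 addrA.
rewrite (_ : lift ord0 ord0 = 1); last exact/val_inj.
by rewrite (_ : lift ord0 (lift _ _) = 2%:R); last exact/val_inj.
Qed.

Lemma cliffE :
  ((cliff R 0 0 0 = 0) * (cliff R 0 0 1 = I_) * (cliff R 0 1 0 = I_) *
   (cliff R 0 1 1 = 0) * (cliff R 1 0 0 = 0) * (cliff R 1 0 1 = 1) *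
   (cliff R 1 1 0 = -1) * (cliff R 1 1 1 = 0) * (cliff R 2%:R 0 0 = I_) *
   (cliff R 2%:R 0 1 = 0) * (cliff R 2%:R 1 0 = 0) *
   (cliff R 2%:R 1 1 = - I_))%type.
Proof. by do !split; rewrite /cliff /= mxE. Qed.

Lemma mul_ii : I_ * I_ = -1.
Proof. by apply/eqP; rewrite eq_complex /=; apply/andP; split; apply/eqP; ring. Qed.

Lemma rcN (a : R) : rc (- a) = - rc a. Proof. exact: (rmorphN (real_complex R)). Qed.
Lemma rcD (a b : R) : rc (a + b) = rc a + rc b. Proof. exact: (rmorphD (real_complex R)). Qed.
Lemma rcM (a b : R) : rc (a * b) = rc a * rc b. Proof. exact: (rmorphM (real_complex R)). Qed.
Lemma rcV (a : R) : rc (a^-1) = (rc a)^-1. Proof. exact: (fmorphV (real_complex R)). Qed.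
Lemma rcX (a : R) n : rc (a ^+ n) = rc a ^+ n. Proof. exact: (rmorphXn (real_complex R)). Qed.
Lemma rc_nat n : rc n%:R = n%:R. Proof. exact: (rmorph_nat (real_complex R)). Qed.
Lemma rc_sum n (F : 'I_n -> R) : rc (\sum_i F i) = \sum_i rc (F i).
Proof. exact: (rmorph_sum (real_complex R)). Qed.
Lemma rc_eq0 (a : R) : (rc a == 0) = (a == 0).
Proof. exact: (fmorph_eq0 (real_complex R)). Qed.

(** Clifford multiplication by the position vector, in Euclidean normalisation. *)
Definition cliff_pos x : 'M[C]_2 := \sum_j rc (x 0 j) *: cliff R j.

Lemma cliff_posE x a b : cliff_pos x a b = rc (x 0 0) * cliff R 0 a b + rc (x 0 1) * cliff R 1 a b
  + rc (x 0 2%:R) * cliff R 2%:R a b.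
Proof. by rewrite /cliff_pos sum3E !mxE. Qed.

Lemma rc_nsq x : rc (nsq x) = rc (x 0 0) ^+ 2 + rc (x 0 1) ^+ 2 + rc (x 0 2%:R) ^+ 2.
Proof. by rewrite /nsq sum3E !rcD !rcX. Qed.

(** The Clifford relation c_j c_k + c_k c_j = -2 delta_jk. *)
Lemma cliff_anticomm j k : cliff R j *m cliff R k + cliff R k *m cliff R j
  = (- (2 * (j == k)%:R))%:M.
Proof.
have ii := mul_ii.
apply/matrixP; elim/ord3_ind: j; elim/ord3_ind: k; elim/ord2_ind; elim/ord2_ind;
  by rewrite !mxE !sum2E !cliffE /=; ring: ii.
Qed.

Lemma cliff_sq j : cliff R j *m cliff R j = - 1%:M.
Proof.
have s := cliff_anticomm j j.
have two0 : (2 : C) != 0 by rewrite pnatr_eq0.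
apply: (scalerI two0); rewrite scaler_nat mulr2n s eqxx mulr1 raddfN/=.
by rewrite scalerN scale_scalar_mx mulr1.
Qed.

Lemma cliff_pos_anticomm x j : cliff_pos x *m cliff R j + cliff R j *m cliff_pos x
  = (- (2 * rc (x 0 j)))%:M.
Proof.
rewrite /cliff_pos mulmx_suml mulmx_sumr -big_split/= (bigD1 j)//= big1 => [|i /negPf ij].
  by rewrite -scalemxAl -scalemxAr -scalerDr cliff_anticomm eqxx scale_scalar_mx addr0
    mulrN mulr1 mulrC.
by rewrite -scalemxAl -scalemxAr -scalerDr cliff_anticomm ij scale_scalar_mx
  mulr0 oppr0 mulr0 raddf0.
Qed.

Lemma cliff_pos_sq x : cliff_pos x *m cliff_pos x = - (rc (nsq x))%:M.
Proof.
have h : cliff_pos x *m cliff_pos x + cliff_pos x *m cliff_pos x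
  = - (rc (nsq x))%:M - (rc (nsq x))%:M.
  transitivity (\sum_j rc (x 0 j) *: (cliff_pos x *m cliff R j + cliff R j *m cliff_pos x)).
    under eq_bigr do rewrite scalerDr; rewrite big_split/=; congr (_ + _).
      by rewrite {2}/cliff_pos mulmx_sumr; apply: eq_bigr => j _; rewrite scalemxAr.
    by rewrite {1}/cliff_pos mulmx_suml; apply: eq_bigr => j _; rewrite scalemxAl.
  rewrite /nsq rc_sum !raddf_sum/= -big_split/=; apply: eq_bigr => j _.
  rewrite cliff_pos_anticomm scale_scalar_mx -!raddfN -raddfD/=.
  by congr (_%:M); rewrite rcX; ring.
have two0 : (2 : C) != 0 by rewrite pnatr_eq0.
by apply: (scalerI two0); rewrite !scaler_nat !mulr2n.
Qed.

(** Anticommuting turns 1/4 sum_jk (x_j delta_kl - x_k delta_jl) c_j c_k, which is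
    1/4 (X c_l - c_l X), into a single product. *)
Lemma spin_connE x l :
  spin_conn x l = 2^-1 *: (cliff_pos x *m cliff R l + (rc (x 0 l))%:M).
Proof.
have E : \sum_j \sum_k rc (levi_civita x l j k) *: (cliff R j *m cliff R k)
    = cliff_pos x *m cliff R l - cliff R l *m cliff_pos x.
  transitivity (\sum_j \sum_k ((rc (x 0 j) * (k == l)%:R) *: (cliff R j *m cliff R k))
      - \sum_j \sum_k ((rc (x 0 k) * (j == l)%:R) *: (cliff R j *m cliff R k))).
    rewrite -sumrB; apply: eq_bigr => j _; rewrite -sumrB; apply: eq_bigr => k _.
    by rewrite rcD rcN !rcM !rc_nat scalerBl.
  congr (_ - _).
    rewrite /cliff_pos mulmx_suml; apply: eq_bigr => j _; rewrite (bigD1 l)//= eqxx mulr1.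
    by rewrite -scalemxAl big1 ?addr0// => k /negPf ->; rewrite mulr0 scale0r.
  rewrite (bigD1 l)//= [X in _ + X]big1 ?addr0 => [|j /negPf jl]; last first.
    by rewrite big1// => k _; rewrite jl mulr0 scale0r.
  by rewrite /cliff_pos mulmx_sumr; apply: eq_bigr => k _; rewrite eqxx mulr1 scalemxAr.
have h := cliff_pos_anticomm x l.
rewrite /spin_conn E (_ : cliff R l *m cliff_pos x
  = (- (2 * rc (x 0 l)))%:M - cliff_pos x *m cliff R l).
  by apply/matrixP => a b; rewrite !mxE; case: (a == b) => /=; field.
by rewrite -h addrC addKr.
Qed.
Lemma sum3_cyclic (V : nmodType) (F : 'I_3 -> V) j :
  \sum_i F i = F j + F (j + 1) + F (j + 2%:R).
Proof.
have e12 : 1 + 2%:R = 0 :> 'I_3 by apply/val_inj.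
have e21 : 2%:R + 1 = 0 :> 'I_3 by apply/val_inj.
have e22 : 2%:R + 2%:R = 1 :> 'I_3 by apply/val_inj.
rewrite sum3E; elim/ord3_ind: j; first by rewrite !add0r.
  by rewrite -[1 + 1]/(2%:R) e12 -addrA addrC.
by rewrite e21 e22 addrC addrA.
Qed.

(** The orientation: c_1 c_2 c_3 = 1 and c_3^2 = -1. *)
Lemma cliff_cyclic j : cliff R j *m cliff R (j + 1) = - cliff R (j + 2%:R).
Proof.
have ii := mul_ii.
have e12 : 1 + 2%:R = 0 :> 'I_3 by apply/val_inj.
have e21 : 2%:R + 1 = 0 :> 'I_3 by apply/val_inj.
have e22 : 2%:R + 2%:R = 1 :> 'I_3 by apply/val_inj.
apply/matrixP; elim/ord3_ind: j; elim/ord2_ind; elim/ord2_ind;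
  rewrite ?add0r -?[1 + 1]/(2%:R) ?e12 ?e21 ?e22 mxE sum2E [RHS]mxE !cliffE; by ring: ii.
Qed.

Lemma cliff_swap j k : j != k -> cliff R j *m cliff R k = - (cliff R k *m cliff R j).
Proof.
move=> /negPf jk; have := cliff_anticomm j k; rewrite jk mulr0 oppr0 raddf0.
by move/eqP; rewrite addr_eq0 => /eqP.
Qed.

Lemma add1_neq (j : 'I_3) : j != j + 1. Proof. by elim/ord3_ind: j. Qed.
Lemma add2_neq (j : 'I_3) : j != j + 2%:R. Proof. by elim/ord3_ind: j. Qed.
Lemma add12_neq (j : 'I_3) : j + 1 != j + 2%:R. Proof. by elim/ord3_ind: j. Qed.
Lemma ord3_add21 (j : 'I_3) : j + 2%:R + 1 = j. Proof. by elim/ord3_ind: j; apply/val_inj. Qed.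
Lemma ord3_add22 (j : 'I_3) : j + 2%:R + 2%:R = j + 1. Proof. by elim/ord3_ind: j;
  apply/val_inj. Qed.
Lemma ord3_add11 (j : 'I_3) : j + 1 + 1 = j + 2%:R. Proof. by elim/ord3_ind: j; apply/val_inj. Qed.
Lemma ord3_add12 (j : 'I_3) : j + 1 + 2%:R = j. Proof. by elim/ord3_ind: j; apply/val_inj. Qed.

Lemma cliff_cyclic12 j : cliff R (j + 1) *m cliff R (j + 2%:R) = - cliff R j.
Proof. by rewrite -ord3_add11 cliff_cyclic ord3_add12. Qed.

Lemma cliff_cyclic20 j : cliff R (j + 2%:R) *m cliff R j = - cliff R (j + 1).
Proof. by rewrite -[in cliff R j](ord3_add21 j) cliff_cyclic ord3_add22. Qed.

Lemma cliff_pos_cliff x j : cliff_pos x *m cliff R j = rc (x 0 (j + 1)) *: cliff R (j + 2%:R)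
  - rc (x 0 (j + 2%:R)) *: cliff R (j + 1) - (rc (x 0 j))%:M.
Proof.
rewrite /cliff_pos (sum3_cyclic _ j) !mulmxDl -!scalemxAl cliff_sq cliff_cyclic20.
rewrite (@cliff_swap (j + 1) j) 1?eq_sym ?add1_neq// cliff_cyclic opprK !scalerN.
by rewrite scalemx1 -addrA addrC.
Qed.

Lemma tr_cliff j : \tr (cliff R j) = 0.
Proof. by rewrite /mxtrace sum2E; elim/ord3_ind: j; rewrite !cliffE ?addr0 ?subrr. Qed.

End Clifford.

(** * Killing spinors of hyperbolic space *)

Section Killing.
Variable R : realType.
Implicit Types x : 'rV[R]_3.
Local Notation C := R[i].
Local Notation I_ := (@Complex R 0 1).
Local Notation rc r := (@Complex R r 0).
Local Notation e_ j := (delta_mx 0 j : 'rV[R]_3).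

Lemma pm_sq s : pm R s * pm R s = 1.
Proof. by case: s; rewrite /pm ?mulrNN mulr1. Qed.

(** The Killing equation reads nabla_v psi = (e / 2) v psi; e is a square root of -1. *)
Definition killing_coef s : C := pm R s * I_.

Lemma killing_coef_sq s : killing_coef s * killing_coef s = -1.
Proof. by rewrite /killing_coef mulrACA pm_sq mul_ii mul1r. Qed.

Lemma mulmx2E (A : 'M[C]_2) (v : 'cV[C]_2) a :
  (A *m v) a 0 = A a 0 * v 0 0 + A a 1 * v 1 0.
Proof. by rewrite mxE sum2E. Qed.

Lemma rc_lam_neq0 x : H3 x -> rc (lam x) != 0.
Proof.
by move=> Hx; rewrite rc_eq0 mulf_neq0// invr_eq0 lt0r_neq0// H3_gt0.
Qed.

(** The Killing equation solved for the coordinate derivative. *)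
Lemma killing_partial s psi x l : killing s psi -> H3 x ->
  mpartial l psi x = (rc (lam x) / 2) *: ((killing_coef s *: cliff R l
     - cliff_pos x *m cliff R l - (rc (x 0 l))%:M) *m psi x).
Proof.
move=> [_ K] Hx.
have l0 := rc_lam_neq0 Hx.
have := K x l Hx; rewrite /nabla spin_connE rcV => /(canRL (addrK _)) E.
have -> : mpartial l psi x = rc (lam x) *: ((rc (lam x))^-1 *: mpartial l psi x).
  by rewrite scalerA divff// scale1r.
rewrite E -[_ / 2]/(_ * _) -scalerA; congr (_ *: _).
rewrite -[pm R s * I_]/(killing_coef s) -!scalemxAl !mulmxBl scalerBr scalerBr mulmxDl.
by rewrite -scalemxAl scalerA scalerDr opprD addrA [2^-1 * _]mulrC.
Qed.

Definition conf_isqrt x : R := (Num.sqrt (1 - nsq x))^-1.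

Lemma has_partial_conf_isqrt (l : 'I_3) x : H3 x ->
  has_partial (e_ l) conf_isqrt x (x 0 l * conf_isqrt x / (1 - nsq x)).
Proof.
move=> /H3_gt0 h0; have s0 : Num.sqrt (1 - nsq x) != 0 by rewrite sqrtr_eq0 -ltNge.
have := has_partial_comp (is_derive1_sqrt h0) (has_partial_subnsq l x).
move=> /(has_partialV s0) H; apply: (has_partial_eq H) => //.
rewrite /conf_isqrt; set r := Num.sqrt _ in s0 *.
have -> : 1 - nsq x = r ^+ 2 by rewrite sqr_sqrtr// ltW.
by field.
Qed.

Lemma ball_ccst (f : 'rV[R]_3 -> C) :
  (forall x (j : 'I_3), H3 x -> has_cpartial (e_ j) f x 0) ->
  forall x, H3 x -> f x = f 0.
Proof.
move=> f0 x Hx; apply/eqP; rewrite eq_complex; apply/andP; split; apply/eqP.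
  by apply: (ball_cst (f := fun z => complex.Re (f z))) => // z j /(f0 z j)[].
by apply: (ball_cst (f := fun z => complex.Im (f z))) => // z j /(f0 z j)[].
Qed.

Lemma has_cpartial_coord (l j : 'I_3) x :
  has_cpartial (e_ l) (fun z => rc (z 0 j)) x (j == l)%:R.
Proof. by have := has_cpartial_rc (has_partial_coord l j x); rewrite rc_nat. Qed.

Lemma has_cpartial_cliff_pos (l : 'I_3) x a b :
  has_cpartial (e_ l) (fun z => cliff_pos z a b) x (cliff R l a b).
Proof.
have := has_cpartial_sum (fun j => has_cpartialM (has_cpartial_coord l j x)
  (has_cpartial_cst (e_ l) x (cliff R j a b))).
congr has_cpartial.
  by apply/funext => z; rewrite /cliff_pos summxE; apply: eq_bigr => j _; rewrite mxE.
rewrite (bigD1 l)//= eqxx mulr0 add0r mulr1 big1 ?addr0// => j /negPf ->.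
by rewrite !mulr0 addr0.
Qed.

(** Here e^2 = -1 and X^2 = -|x|^2 make the left factor absorb the term X c_l. *)
Lemma killing_factor s x l : (1%:M - killing_coef s *: cliff_pos x)
    *m (killing_coef s *: cliff R l - cliff_pos x *m cliff R l - (rc (x 0 l))%:M)
  = (killing_coef s * (1 - rc (nsq x))) *: cliff R l
    - rc (x 0 l) *: (1%:M - killing_coef s *: cliff_pos x).
Proof.
have e2 := killing_coef_sq s; set e := killing_coef s in e2 *.
rewrite mulmxBr mul_mx_scalar; congr (_ - _).
rewrite mulmxBl mul1mx mulmxBr -!scalemxAl -!scalemxAr scalerA e2 mulmxA cliff_pos_sq.
rewrite mulNmx mul_scalar_mx scaleN1r scalerN opprB !opprK -addrA [X in _ + X]addrC.
by rewrite addrK mulrBr mulr1 scalerBl scalerA.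
Qed.

(** The factor is the inverse of the one by which a Killing spinor differs from a constant
    spinor. *)
Definition untwist s (psi : spinor R) x : 'cV[C]_2 :=
  rc (conf_isqrt x) *: ((1%:M - killing_coef s *: cliff_pos x) *m psi x).

(** The derivative of (1 - |x|^2)^(-1/2) cancels the multiple of 1 - e X left over by
    [killing_factor]. *)
Lemma has_cpartial_untwist s psi (l : 'I_3) x a : killing s psi -> H3 x ->
  has_cpartial (e_ l) (fun z => untwist s psi z a 0) x 0.
Proof.
move=> /[dup] K [sm _] Hx.
have dpsi b := csmooth_has_cpartial l (sm b 0 : csmooth _ _) Hx.
have dM b : has_cpartial (e_ l) (fun z => (1%:M - killing_coef s *: cliff_pos z) a b) x
    (- killing_coef s * cliff R l a b).
  have := has_cpartialD (has_cpartial_cst (e_ l) x ((a == b)%:R))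
    (has_cpartialM (has_cpartial_cst (e_ l) x (- killing_coef s)) (has_cpartial_cliff_pos l x a b)).
  congr has_cpartial; last by rewrite mulr0 add0r addr0.
  by apply/funext => z; rewrite !mxE mulNr.
have := has_cpartialM (has_cpartial_rc (has_partial_conf_isqrt l Hx))
  (has_cpartial_sum (fun b => has_cpartialM (dM b) (dpsi b))).
congr has_cpartial; first by apply/funext => z; rewrite /untwist !mxE.
have h0 := lt0r_neq0 (H3_gt0 Hx).
have q0 : 1 - rc (nsq x) != 0 by rewrite -[1]/(rc 1) -rcN -rcD rc_eq0.
have D : (1%:M - killing_coef s *: cliff_pos x) *m mpartial l psi x
    = killing_coef s *: cliff R l *m psi x
      - (rc (x 0 l) / (1 - rc (nsq x))) *: ((1%:M - killing_coef s *: cliff_pos x) *m psi x).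
  rewrite (killing_partial l K Hx) -scalemxAr mulmxA killing_factor.
  rewrite /lam rcM rcV rc_nat rcD rcN -[Complex 1 0]/(1 : C) mulmxBl scalerBr -!scalemxAl !scalerA.
  by congr (_ *: _ - _ *: _); field.
have {D} : ((1%:M - killing_coef s *: cliff_pos x) *m mpartial l psi x) a 0
  = (killing_coef s *: cliff R l *m psi x
      - (rc (x 0 l) / (1 - rc (nsq x))) *: ((1%:M - killing_coef s *: cliff_pos x) *m psi x)) a 0.
  by rewrite D.
have entryBZ (u w : 'cV[C]_2) c : (u - c *: w) a 0 = u a 0 - c * w a 0 by rewrite !mxE.
rewrite entryBZ !mulmx2E => D.
rewrite !sum2E !rcM rcV rcD rcN -[Complex 1 0]/(1 : C).
transitivity (rc (conf_isqrt x) * (((1%:M - killing_coef s *: cliff_pos x) a 0 * mpartial l psi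
  x 0 0 +
   (1%:M - killing_coef s *: cliff_pos x) a 1 * mpartial l psi x 1 0)
   - killing_coef s * (cliff R l a 0 * psi x 0 0 + cliff R l a 1 * psi x 1 0)
   + rc (x 0 l) / (1 - rc (nsq x)) * ((1%:M - killing_coef s *: cliff_pos x) a 0 * psi x 0 0 +
   (1%:M - killing_coef s *: cliff_pos x) a 1 * psi x 1 0))).
  by field.
rewrite D ![(killing_coef s *: cliff R l) _ _]mxE; field.
exact: q0.
Qed.

(** The untwisted spinor is constant on the ball, and (1 + e X) (1 - e X) = 1 - |x|^2. *)
Lemma killing_formula s psi x : killing s psi -> H3 x ->
  psi x = rc (conf_isqrt x) *: ((1%:M + killing_coef s *: cliff_pos x) *m psi 0).
Proof.
move=> K Hx.
have D : untwist s psi x = psi 0.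
  have -> : psi 0 = untwist s psi 0.
    have n0 : @nsq R 3 0 = 0 by rewrite /nsq big1// => j _; rewrite mxE expr0n.
    have c0 : cliff_pos (0 : 'rV[R]_3) = 0.
      by rewrite /cliff_pos big1// => j _; rewrite mxE scale0r.
    rewrite /untwist /conf_isqrt n0 c0.
    by rewrite subr0 sqrtr1 invr1 scaler0 subr0 mul1mx scale1r.
  apply/matrixP => a b; rewrite ord1.
  by apply: (ball_ccst (f := fun z => untwist s psi z a 0)) => // z j; apply: has_cpartial_untwist.
have h0 := H3_gt0 Hx.
have E : (1%:M + killing_coef s *: cliff_pos x) *m (1%:M - killing_coef s *: cliff_pos x)
    = (1 - rc (nsq x))%:M.
  rewrite mulmxDl mul1mx mulmxBr mulmx1 -scalemxAl -scalemxAr scalerA killing_coef_sq.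
  by rewrite cliff_pos_sq scalerN scaleN1r opprK addrA subrK raddfB.
rewrite -D /untwist -scalemxAr mulmxA E mul_scalar_mx !scalerA.
rewrite -[1]/(rc 1) -rcN -rcD -!rcM mulrA -expr2 /conf_isqrt exprVn sqr_sqrtr ?ltW//.
by rewrite mulVf ?scale1r// lt0r_neq0.
Qed.
End Killing.

(** * Leibniz rules for matrix functions *)

Section MatrixDerivative.
Variables (R : realType) (k m n : nat).
Local Notation C := R[i].
Implicit Types (F G : 'rV[R]_k -> 'M[C]_(m, n)) (x v : 'rV[R]_k).

Lemma has_cpartial_eq v x (f g : 'rV[R]_k -> C) a b :
  has_cpartial v f x a -> f =1 g -> a = b -> has_cpartial v g x b.
Proof. by move=> ? /funext <- <-. Qed.

Definition has_mpartial v F x (D : 'M[C]_(m, n)) : Prop :=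
  forall p q, has_cpartial v (fun z => F z p q) x (D p q).

Lemma has_mpartial_eq v F G x D E : has_mpartial v F x D -> F =1 G -> D = E ->
  has_mpartial v G x E.
Proof. by move=> H /funext <- <-. Qed.

Lemma has_mpartialD v F G x D E : has_mpartial v F x D -> has_mpartial v G x E ->
  has_mpartial v (fun z => F z + G z) x (D + E).
Proof.
move=> hF hG p q; have := has_cpartialD (hF p q) (hG p q).
by move/has_cpartial_eq; apply=> [z|]; rewrite ?mxE.
Qed.

Lemma has_mpartialZ v c dc F x D : has_cpartial v c x dc -> has_mpartial v F x D ->
  has_mpartial v (fun z => c z *: F z) x (c x *: D + dc *: F x).
Proof.
move=> hc hF p q; have := has_cpartialM hc (hF p q).
by move/has_cpartial_eq; apply=> [z|]; [rewrite mxE|rewrite !mxE [dc * _]mulrC].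
Qed.

Lemma has_mpartial_sum v N (F : 'I_N -> 'rV[R]_k -> 'M[C]_(m, n)) x D :
  (forall i, has_mpartial v (F i) x (D i)) ->
  has_mpartial v (fun z => \sum_i F i z) x (\sum_i D i).
Proof.
move=> H p q; have := has_cpartial_sum (fun i => H i p q).
by move/has_cpartial_eq; apply=> [z|]; rewrite ?summxE.
Qed.

Lemma mpartial_eq (j : 'I_k) F x D :
  has_mpartial (delta_mx 0 j) F x D -> mpartial j F x = D.
Proof. by move=> H; apply/matrixP => p q; apply: mpartial_entry. Qed.

Lemma msmooth_has_mpartial U F x (j : 'I_k) : msmooth_on U F -> U x ->
  has_mpartial (delta_mx 0 j) F x (mpartial j F x).
Proof. by move=> sF Ux p q; apply: csmooth_has_cpartial Ux; apply: sF. Qed.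
End MatrixDerivative.

(** * The linearised Bogomolny equation and the gauge condition *)

Section LinearisedEquations.
Variable R : realType.
Implicit Types x : 'rV[R]_3.
Local Notation C := R[i].
Local Notation M2 := 'M[C]_2.
Local Notation I_ := (@Complex R 0 1).
Local Notation rc r := (@Complex R r 0).
Local Notation e_ j := (delta_mx 0 j : 'rV[R]_3).

Definition cospinor (psi : 'cV[C]_2) (a : 'I_2) : C :=
  if a == 0 then - psi 1 0 else psi 0 0.

(** The element (psi, M f) of End_0 (V), for a spinor f with values in End_0 (V). *)
Definition spinor_contract (M : M2) (psi : 'cV[C]_2) (f : 'I_2 -> M2) : M2 :=
  \sum_a \sum_b M a b *: (cospinor psi a *: f b).

Lemma clH_inv1E (nu : tspinor R) psi x j : (clH_inv (tensor nu psi)).1 x j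
  = (- (rc (lam x) / 2)) *: spinor_contract (cliff R j) (psi x) (nu x).
Proof. by []. Qed.

Lemma clH_inv2E (nu : tspinor R) psi x : (clH_inv (tensor nu psi)).2 x
  = (1 / 2) *: spinor_contract 1%:M (psi x) (nu x).
Proof.
rewrite /clH_inv /spinor_contract/=; congr (_ *: _); apply: eq_bigr => a _.
rewrite (bigD1 a)//= big1 => [|b /negPf ba]; last by rewrite mxE eq_sym ba scale0r.
by rewrite mxE eqxx scale1r addr0.
Qed.

Lemma lieZr (X Y : M2) c : lie X (c *: Y) = c *: lie X Y.
Proof. by rewrite /lie -scalemxAr -scalemxAl scalerBr. Qed.

Lemma lieDr (X Y Z : M2) : lie X (Y + Z) = lie X Y + lie X Z.
Proof. by rewrite /lie mulmxDr mulmxDl opprD addrACA. Qed.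

Lemma lieC (X Y : M2) : lie X Y = - lie Y X.
Proof. by rewrite /lie opprB. Qed.

Lemma lie_sumr (X : M2) n (F : 'I_n -> M2) : lie X (\sum_i F i) = \sum_i lie X (F i).
Proof. by rewrite /lie mulmx_sumr mulmx_suml -sumrB. Qed.

Lemma lie_contract (B M : M2) psi f :
  lie B (spinor_contract M psi f) = spinor_contract M psi (fun b => lie B (f b)).
Proof.
rewrite /spinor_contract lie_sumr; apply: eq_bigr => a _; rewrite lie_sumr.
by apply: eq_bigr => b _; rewrite !lieZr.
Qed.

Lemma contractDr (M : M2) psi f g :
  spinor_contract M psi (fun b => f b + g b) = spinor_contract M psi f + spinor_contract M psi g.
Proof.
rewrite /spinor_contract -big_split/=; apply: eq_bigr => a _.
by rewrite -big_split/=; apply: eq_bigr => b _; rewrite !scalerDr.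
Qed.

Lemma has_mpartial_contract (M : M2) psi nu l x dpsi dnu :
  has_mpartial (e_ l) psi x dpsi ->
  (forall b : 'I_2, has_mpartial (e_ l) (fun z => nu z b) x (dnu b)) ->
  has_mpartial (e_ l) (fun z => spinor_contract M (psi z) (nu z)) x
    (spinor_contract M (psi x) dnu + spinor_contract M dpsi (nu x)).
Proof.
move=> hpsi hnu.
have hw a : has_cpartial (e_ l) (fun z => cospinor (psi z) a) x (cospinor dpsi a).
  rewrite /cospinor; case: eqP => _; last exact: hpsi.
  have := has_cpartialM (has_cpartial_cst (e_ l) x (-1)) (hpsi 1 0).
  by move/has_cpartial_eq; apply=> [z|]; rewrite mulN1r// mulr0 addr0.
apply: (has_mpartial_eq (has_mpartial_sum (fun a => has_mpartial_sum (fun b =>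
  has_mpartialZ (has_cpartial_cst (e_ l) x (M a b)) (has_mpartialZ (hw a) (hnu b)))))) => //.
rewrite /spinor_contract -big_split/=; apply: eq_bigr => a _.
by rewrite -big_split/=; apply: eq_bigr => b _; rewrite scale0r addr0 scalerDr.
Qed.

Definition cov_partial (B : M2) (nu : tspinor R) l x : 'I_2 -> M2 :=
  fun b => mpartial l (fun y => nu y b) x + lie B (nu x b).

(** The pairing of spinors is constant in the frame, so the covariant derivative of a
    contraction differentiates the two spinors; the Lie bracket acts on f only. *)
Lemma contract_leibniz (nu : tspinor R) psi (c : 'rV[R]_3 -> C) dc (B M : M2) l x :
  (forall a, msmooth_on (@H3 R) (fun x => nu x a)) -> msmooth_on (@H3 R) psi -> H3 x ->
  has_cpartial (e_ l) c x dc ->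
  mpartial l (fun y => c y *: spinor_contract M (psi y) (nu y)) x
    + lie B (c x *: spinor_contract M (psi x) (nu x))
  = dc *: spinor_contract M (psi x) (nu x)
    + c x *: (spinor_contract M (mpartial l psi x) (nu x) + spinor_contract M (psi x)
      (cov_partial B nu l x)).
Proof.
move=> snu spsi Hx hc; rewrite lieZr lie_contract.
have dpsi := msmooth_has_mpartial l spsi Hx.
have dnu b := msmooth_has_mpartial l (snu b) Hx.
rewrite (mpartial_eq (has_mpartialZ hc (has_mpartial_contract M dpsi dnu))).
have -> : spinor_contract M (psi x) (cov_partial B nu l x)
  = spinor_contract M (psi x) (fun b => mpartial l (fun z => nu z b) x)
    + spinor_contract M (psi x) (fun b => lie B (nu x b)) by rewrite -contractDr.
move: (spinor_contract M (psi x) (fun b => lie B _)) (spinor_contract M (mpartial _ _ _) _) => L V.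
move: (spinor_contract M _ (fun b => _)) (spinor_contract M _ _) (c x) => U W c0.
by rewrite !scalerDr !addrA (ACl (3*2*1*4)%AC).
Qed.

(** The spin connection contributes X to the Dirac operator, because the sum of the
    c_l X c_l is X. *)
Lemma cliff_spin x : \sum_l cliff R l *m spin_conn x l = cliff_pos x.
Proof.
have E l : cliff R l *m spin_conn x l =
   2^-1 *: (cliff_pos x) - (2^-1 * rc (x 0 l)) *: cliff R l.
  have h := cliff_pos_anticomm x l; have s := cliff_sq R l.
  rewrite spin_connE -scalemxAr mulmxDr mulmxA mul_mx_scalar -scalerA -scalerBr.
  congr (_ *: _).
  have {}h : cliff R l *m cliff_pos x = (- (2 * rc (x 0 l)))%:M - cliff_pos x *m cliff R l.
    by rewrite -h addrC addKr.
  rewrite h mulmxBl -mulmxA s mul_scalar_mx mulmxN mulmx1 opprK addrAC -scalerDl addrC.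
  by congr (_ + _); rewrite -scaleNr; congr (_ *: _); ring.
rewrite (eq_bigr _ (fun l _ => E l)) sumrB sumr_const card_ord.
under [X in _ - X]eq_bigr do rewrite -scalerA.
rewrite -scaler_sumr -[\sum_i _]/(cliff_pos x) scalerMnl -scalerBl -[RHS]scale1r.
by congr (_ *: _); rewrite -mulr_natr; field.
Qed.

Lemma act_S_comp (X Y : M2) (f : 'I_2 -> M2) a :
  act_S X (act_S Y f) a = act_S (X *m Y) f a.
Proof.
rewrite /act_S; under eq_bigr do rewrite scaler_sumr.
rewrite exchange_big/=; apply: eq_bigr => c _; rewrite mxE scaler_suml.
by apply: eq_bigr => b _; rewrite scalerA.
Qed.

(** The Dirac equation solved for the commutator with the Higgs field. *)
Lemma dirac_lie n twop (m : hpair R) s nu x a :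
  eigenspinor n twop m s nu -> H3 x ->
  lie (m.2 x) (nu x a)
  = (rc (lam x))^-1 *: (\sum_l act_S (cliff R l) (cov_partial (m.1 x l) nu l x) a)
    + act_S (cliff_pos x) (nu x) a - (killing_coef R s / 2) *: nu x a.
Proof.
move=> [_ _ E _] Hx; have := E x a Hx.
have -> : Defs.dirac m nu x a = (rc (lam x))^-1 *:
    (\sum_l act_S (cliff R l) (cov_partial (m.1 x l) nu l x) a) + act_S (cliff_pos x) (nu x) a.
  rewrite -cliff_spin scaler_sumr.
  rewrite (_ : act_S (\sum_l _) (nu x) a = \sum_l act_S (cliff R l *m spin_conn x l) (nu x) a).
    rewrite -big_split/=; apply: eq_bigr => l _.
    rewrite -act_S_comp /act_S/tnabla scaler_sumr -big_split/=; apply: eq_bigr => b _.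
    by rewrite scalerDr rcV !scalerA [_ * cliff _ _ _ _]mulrC.
  rewrite /act_S exchange_big/=; apply: eq_bigr => b _.
  by rewrite summxE scaler_suml.
rewrite -[pm R s * _]/(killing_coef R s) => <-; by rewrite opprB addrC subrK.
Qed.
End LinearisedEquations.

Section Equations.
Variable R : realType.
Implicit Types x : 'rV[R]_3.
Local Notation C := R[i].
Local Notation M2 := 'M[C]_2.
Local Notation I_ := (@Complex R 0 1).
Local Notation rc r := (@Complex R r 0).
Local Notation e_ j := (delta_mx 0 j : 'rV[R]_3).

Lemma contractZl (c : C) (M : M2) psi f : c *: spinor_contract M psi f
  = spinor_contract (c *: M) psi f.
Proof.
rewrite /spinor_contract scaler_sumr; apply: eq_bigr => a _.
by rewrite scaler_sumr; apply: eq_bigr => b _; rewrite mxE [LHS]scalerA.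
Qed.

Lemma contractDl (M N : M2) psi f :
  spinor_contract M psi f + spinor_contract N psi f = spinor_contract (M + N) psi f.
Proof.
rewrite /spinor_contract -big_split; apply: eq_bigr => a _.
by rewrite -big_split; apply: eq_bigr => b _; rewrite mxE/= scalerDl.
Qed.

Lemma contract_suml N (M : 'I_N -> M2) (f : 'cV[C]_2) g :
  \sum_j spinor_contract (M j) f g = spinor_contract (\sum_j M j) f g.
Proof.
elim: N M => [|N IH] M; last by rewrite !big_ord_recl IH contractDl.
by rewrite !big_ord0 /spinor_contract big1// => a _; rewrite big1// => b _; rewrite mxE scale0r.
Qed.

Lemma contractZr (c : C) (M : M2) psi f :
  spinor_contract M psi (fun b => c *: f b) = spinor_contract (c *: M) psi f.
Proof.
rewrite /spinor_contract; apply: eq_bigr => a _; apply: eq_bigr => b _.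
by rewrite mxE !scalerA; congr (_ *: _); rewrite mulrAC [M a b * c]mulrC.
Qed.

Lemma contract_sumr n (M : M2) psi (f : 'I_n -> 'I_2 -> M2) :
  spinor_contract M psi (fun b => \sum_l f l b) = \sum_l spinor_contract M psi (f l).
Proof.
rewrite /spinor_contract [RHS]exchange_big/=; apply: eq_bigr => a _.
rewrite [RHS]exchange_big/=; apply: eq_bigr => b _.
by rewrite !scaler_sumr.
Qed.

Lemma contract_act (M N : M2) psi f : spinor_contract M psi (act_S N f)
  = spinor_contract (M *m N) psi f.
Proof.
rewrite /spinor_contract; apply: eq_bigr => a _; rewrite /act_S.
under eq_bigr do rewrite !scaler_sumr.
rewrite exchange_big/=; apply: eq_bigr => c _; rewrite mxE scaler_suml.
apply: eq_bigr => b _.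
by rewrite !scalerA mulrAC.
Qed.

(** The matrix (tr N) - N is the adjoint of N for the skew pairing of spinors. *)
Lemma contract_mulmx (M N : M2) psi f :
  spinor_contract M (N *m psi) f = spinor_contract (((\tr N)%:M - N) *m M) psi f.
Proof.
have adj00 : ((\tr N)%:M - N) 0 0 = N 1 1.
  by rewrite !mxE eqxx mulr1n /mxtrace sum2E addrC addKr.
have adj11 : ((\tr N)%:M - N) 1 1 = N 0 0.
  by rewrite !mxE eqxx mulr1n /mxtrace sum2E addrK.
have adj01 : ((\tr N)%:M - N) 0 1 = - N 0 1 by rewrite !mxE mulr0n sub0r.
have adj10 : ((\tr N)%:M - N) 1 0 = - N 1 0 by rewrite !mxE mulr0n sub0r.
have E b : \sum_c cospinor psi c * (((\tr N)%:M - N) *m M) c b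
    = \sum_c cospinor (N *m psi) c * M c b.
  rewrite !sum2E /cospinor/= !mulmx2E [(_ *m M) 0 b]mxE [(_ *m M) 1 b]mxE !sum2E.
  rewrite adj00 adj01 adj10 adj11.
  move: (N 0 0) (N 0 1) (N 1 0) (N 1 1) (M 0 b) (M 1 b) (psi 0 0) (psi 1 0).
  by move=> n00 n01 n10 n11 m0 m1 p0 p1; ring.
rewrite /spinor_contract exchange_big [RHS]exchange_big/=; apply: eq_bigr => b _.
under eq_bigr do rewrite scalerA mulrC.
under [RHS]eq_bigr do rewrite scalerA mulrC.
by rewrite -!scaler_suml E.
Qed.

(** Minus the matrix in [killing_partial], which is traceless and so is minus its own adjoint. *)
Definition killing_mx s x l : M2 :=
  cliff_pos x *m cliff R l + (rc (x 0 l))%:M - killing_coef R s *: cliff R l.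

Lemma contract_killing s psi x l (M : M2) f : killing s psi -> H3 x ->
  spinor_contract M (mpartial l psi x) f
  = (rc (lam x) / 2) *: spinor_contract (killing_mx s x l *m M) (psi x) f.
Proof.
move=> K Hx; rewrite (killing_partial l K Hx) scalemxAl contract_mulmx.
rewrite (_ : \tr _ = 0); last first.
  rewrite mxtraceZ !linearB/= mxtraceZ mxtrace_scalar tr_cliff mulr0 sub0r.
  rewrite cliff_pos_cliff !linearB/= !mxtraceZ !tr_cliff mxtrace_scalar.
  by rewrite !mulr0 subrr sub0r opprK subrr mulr0.
rewrite raddf0 sub0r contractZl; congr spinor_contract.
rewrite mulNmx -scalemxAl -scalerN -mulNmx; congr (_ *: (_ *m _)).
by rewrite /killing_mx !opprD !opprK -addrA addrC.
Qed.

Section Solution.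
Variables (n twop : nat) (m : hpair R) (s : bool) (nu : tspinor R) (psi : spinor R).
Hypothesis Enu : eigenspinor n twop m s nu.
Hypothesis Kpsi : killing s psi.
Let p := clH_inv (tensor nu psi).
Let P l x := cov_partial (m.1 x l) nu l x.

(** Inserting the Dirac equation in the contraction with psi. *)
Lemma lie_higgs_contract x (M : M2) : H3 x ->
  lie (m.2 x) (spinor_contract M (psi x) (nu x))
  = \sum_l spinor_contract ((rc (lam x))^-1 *: (M *m cliff R l)) (psi x) (P l x)
    + spinor_contract (M *m cliff_pos x - (killing_coef R s / 2) *: M) (psi x) (nu x).
Proof.
move=> Hx; rewrite lie_contract.
rewrite (_ : (fun b => lie (m.2 x) (nu x b)) = fun b =>
    ((rc (lam x))^-1 *: (\sum_l act_S (cliff R l) (P l x) b)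
     + act_S (cliff_pos x) (nu x) b) + (- (killing_coef R s / 2)) *: nu x b); last first.
  by apply/funext => b; rewrite (dirac_lie b Enu Hx) scaleNr.
rewrite !contractDr contract_act !contractZr contract_sumr -addrA contractDl scaleNr.
by congr (_ + _); apply: eq_bigr => l _; rewrite contract_act scalemxAl.
Qed.

Lemma smooth_spinors : (forall a, msmooth_on (@H3 R) (fun x => nu x a)) /\ msmooth_on (@H3 R) psi.
Proof. by split; [case: Enu|case: Kpsi]. Qed.

Lemma leibniz_clH1 (c : 'rV[R]_3 -> C) dc x (M : M2) l : H3 x ->
  has_cpartial (e_ l) c x dc ->
  mpartial l (fun y => c y *: spinor_contract M (psi y) (nu y)) x
    + lie (m.1 x l) (c x *: spinor_contract M (psi x) (nu x))
  = spinor_contract (dc *: M + (c x * (rc (lam x) / 2)) *: (killing_mx s x l *m M)) (psi x) (nu x)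
    + spinor_contract (c x *: M) (psi x) (P l x).
Proof.
move=> Hx hc; have [snu spsi] := smooth_spinors.
rewrite (contract_leibniz _ _ snu spsi Hx hc) (contract_killing _ _ _ Kpsi Hx).
by rewrite scalerDr !contractZl scalerA addrA contractDl.
Qed.

Lemma covd_clH2 x j : H3 x -> covd m.1 p.2 x j
  = spinor_contract ((rc (lam x) / 4) *: killing_mx s x j) (psi x) (nu x)
    + spinor_contract ((1 / 2) *: 1%:M) (psi x) (P j x).
Proof.
move=> Hx; have := leibniz_clH1 1%:M Hx (has_cpartial_cst (e_ j) x (1 / 2)).
rewrite scale0r add0r mulmx1 (_ : 1 / 2 * (rc (lam x) / 2) = rc (lam x) / 4); last by field.
have pE : p.2 = fun y => (1 / 2) *: spinor_contract 1%:M (psi y) (nu y).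
  by apply/funext => y; apply: clH_inv2E.
by move=> <-; rewrite /covd pE.
Qed.

Lemma cov_partial_clH1 x j l : H3 x ->
  mpartial l (fun y => p.1 y j) x + lie (m.1 x l) (p.1 x j)
  = spinor_contract ((- (rc (lam x) ^+ 2 * rc (x 0 l) / 2)) *: cliff R j
        + (- (rc (lam x) ^+ 2 / 4)) *: (killing_mx s x l *m cliff R j)) (psi x) (nu x)
    + spinor_contract ((- (rc (lam x) / 2)) *: cliff R j) (psi x) (P l x).
Proof.
move=> Hx.
have hc := has_cpartialM (has_cpartial_rc (has_partial_lam l Hx)) (has_cpartial_cst (e_ l) x
  (- (1/2))).
have pE y : p.1 y j = (rc (lam y) * - (1 / 2)) *: spinor_contract (cliff R j) (psi y) (nu y).
  by rewrite clH_inv1E; congr (_ *: _); field.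
have pE' : (fun y => p.1 y j) = fun y => (rc (lam y) * - (1 / 2)) *:
    spinor_contract (cliff R j) (psi y) (nu y) by apply/funext => y; apply: pE.
rewrite pE' pE (leibniz_clH1 (cliff R j) Hx hc).
have -> : rc (lam x) * 0 + - (1 / 2) * rc (lam x ^+ 2 * x 0 l)
  = - (rc (lam x) ^+ 2 * rc (x 0 l) / 2) by rewrite rcM rcX; field.
have -> : rc (lam x) * - (1 / 2) * (rc (lam x) / 2) = - (rc (lam x) ^+ 2 / 4) by field.
by have -> : rc (lam x) * - (1 / 2) = - (rc (lam x) / 2) by field.
Qed.

(** The terms without derivatives of nu in the linearised Bogomolny equation.  Everything
    reduces to X c_j = - x_j + x_(j+1) c_(j+2) - x_(j+2) c_(j+1). *)
Lemma bogomolny_clifford x j : H3 x ->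
  (rc (lam x) / 4) *: killing_mx s x j
     + (rc (lam x) / 2) *: (cliff R j *m cliff_pos x - (killing_coef R s / 2) *: cliff R j)
  = (rc (lam x))^-1 *: (((- (rc (lam x) ^+ 2 * rc (x 0 (j + 1)) / 2)) *: cliff R (j + 2%:R)
        + (- (rc (lam x) ^+ 2 / 4)) *: (killing_mx s x (j + 1) *m cliff R (j + 2%:R)))
      - ((- (rc (lam x) ^+ 2 * rc (x 0 (j + 2%:R)) / 2)) *: cliff R (j + 1)
        + (- (rc (lam x) ^+ 2 / 4)) *: (killing_mx s x (j + 2%:R) *m cliff R (j + 1)))).
Proof.
move=> Hx; have l0 := rc_lam_neq0 Hx.
have cX : cliff R j *m cliff_pos x = (- (2 * rc (x 0 j)))%:M - cliff_pos x *m cliff R j.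
  by rewrite -cliff_pos_anticomm addrC addKr.
rewrite cX /killing_mx !mulmxBl !mulmxDl !mul_scalar_mx -!scalemxAl -!mulmxA.
rewrite (@cliff_swap R (j + 2%:R) (j + 1)) 1?eq_sym ?add12_neq// !cliff_cyclic12 opprK.
rewrite mulmxN cliff_pos_cliff.
move: (rc (lam x)) (rc (x 0 j)) (rc (x 0 (j + 1))) (rc (x 0 (j + 2%:R))) (killing_coef R s) l0.
move: (cliff R j) (cliff R (j + 1)) (cliff R (j + 2%:R)) => c0 c1 c2 L x0 x1 x2 e l0.
apply/matrixP => a b; rewrite !mxE !mulrb.
by move: (c0 a b) (c1 a b) (c2 a b) => d0 d1 d2; case: (a == b); field.
Qed.
End Solution.
End Equations.

Section Assembly.
Variables (K : fieldType) (V W : lmodType K).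
Hypothesis two0 : (2 : K) != 0.
Variables (L : K) (L0 : L != 0).

(** The linearised Bogomolny equation involves contractions only through their linearity in
    the Clifford element.  T0 stands for the contraction with nu, and Tj, Tk, Tl for those
    with the derivatives of nu in the directions j, j+1, j+2. *)
Lemma assemble_bogomolny (T0 Tj Tk Tl : W -> V) (o ck cl A F C1 C2 : W) :
  linear T0 -> linear Tj -> linear Tk -> linear Tl ->
  A + (L / 2) *: F = L^-1 *: (C1 - C2) ->
  T0 A + Tj ((1 / 2) *: o)
    + (L / 2) *: (Tj (L^-1 *: - o) + Tk (L^-1 *: - cl) + Tl (L^-1 *: ck) + T0 F)
  = L^-1 *: (T0 C1 + Tk ((- (L / 2)) *: cl) - (T0 C2 + Tl ((- (L / 2)) *: ck))).
Proof.
move=> lin0 linj link linl E.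
pose S0 : {linear W -> V} := HB.pack T0 (GRing.isLinear.Build K W V _ T0 lin0).
pose Sj : {linear W -> V} := HB.pack Tj (GRing.isLinear.Build K W V _ Tj linj).
pose Sk : {linear W -> V} := HB.pack Tk (GRing.isLinear.Build K W V _ Tk link).
pose Sl : {linear W -> V} := HB.pack Tl (GRing.isLinear.Build K W V _ Tl linl).
rewrite -[T0]/(S0 : W -> V) -[Tj]/(Sj : W -> V) -[Tk]/(Sk : W -> V) -[Tl]/(Sl : W -> V).
(* Eliminating A leaves a linear combination of the six values generalised below. *)
have -> : A = L^-1 *: (C1 - C2) - (L / 2) *: F by rewrite -E addrK.
rewrite !(linearB, linearZ, linearN)/=.
move: (S0 F) (S0 C1) (S0 C2) (Sj o) (Sk cl) (Sl ck) => f c1 c2 vo vl vk.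
rewrite !opprD !(scalerDr, scalerN, scalerA, scaleNr).
have e1 : L / 2 * L^-1 = 1 / 2 by field; rewrite two0 L0.
have e2 : L^-1 * (L / 2) = 1 / 2 by field; rewrite two0 L0.
rewrite !(mulrN, scaleNr, opprK) e1 e2; move: ((L / 2) *: f) (L^-1 *: c1)
  (L^-1 *: c2) => f' c1' c2'.
move: ((1 / 2) *: vo) ((1 / 2) *: vl) ((1 / 2) *: vk) => wo wl wk.
by rewrite !addrA [LHS](ACl (1*6*2*7*(4*5)*(3*8))%AC)/= subrr addNr !addr0.
Qed.

(** The analogue for the gauge condition: the derivatives of nu enter the codifferential and
    the commutator with the Higgs field through the same Dirac operator, with opposite signs. *)
Lemma assemble_gauge N (T0 : W -> V) (T : 'I_N -> W -> V) (c A : 'I_N -> W) (o F : W) E :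
  linear T0 -> (forall j, linear (T j)) ->
  L ^- 3 *: (\sum_j A j) + (1 / 2) *: F + (E / 2) *: o = 0 ->
  L ^- 3 *: (\sum_j (T0 (A j) + T j ((- (L ^+ 2 / 2)) *: c j)))
    + (1 / 2) *: (\sum_j T j (L^-1 *: c j) + T0 F) + E *: ((1 / 2) *: T0 o) = 0.
Proof.
move=> lin0 lin H.
pose S0 : {linear W -> V} := HB.pack T0 (GRing.isLinear.Build K W V _ T0 lin0).
pose S j : {linear W -> V} := HB.pack (T j) (GRing.isLinear.Build K W V _ (T j) (lin j)).
have TZ j a : T j (a *: c j) = a *: T j (c j) by rewrite -[T j]/(S j : W -> V) linearZ.
rewrite big_split/= -[T0]/(S0 : W -> V) -linear_sum.
rewrite 2!(eq_bigr _ (fun j _ => TZ j _)).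
rewrite -!scaler_sumr !scalerDr !scalerA.
have e1 : L ^- 3 * - (L ^+ 2 / 2) = - (1 / 2 * L^-1) by field; rewrite two0 L0.
rewrite e1 scaleNr addrA subrK.
by have := congr1 S0 H; rewrite !linearD !linearZ linear0/= => <-; rewrite mul1r.
Qed.

End Assembly.

Section Solution.
Variable R : realType.
Implicit Types x : 'rV[R]_3.
Local Notation C := R[i].
Local Notation M2 := 'M[C]_2.
Local Notation I_ := (@Complex R 0 1).
Local Notation rc r := (@Complex R r 0).
Local Notation e_ j := (delta_mx 0 j : 'rV[R]_3).
Variables (n twop : nat) (m : hpair R) (s : bool) (nu : tspinor R) (psi : spinor R).
Hypothesis Enu : eigenspinor n twop m s nu.
Hypothesis Kpsi : killing s psi.
Let p := clH_inv (tensor nu psi).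
Let P l x := cov_partial (m.1 x l) nu l x.

(** The derivatives of nu match because c_j c_(j+1) = - c_(j+2) and c_j^2 = -1; the other terms
    match by [bogomolny_clifford]. *)
Lemma linearised_bogomolny x j : H3 x ->
  covd m.1 p.2 x j + lie (p.1 x j) (m.2 x) = star2 (covd1 m.1 p.1) x j.
Proof.
move=> Hx; have l0 := rc_lam_neq0 Hx.
(* The covariant derivative of a_k in the direction l. *)
pose G k l := spinor_contract ((- (rc (lam x) ^+ 2 * rc (x 0 l) / 2)) *: cliff R k
        + (- (rc (lam x) ^+ 2 / 4)) *: (killing_mx s x l *m cliff R k)) (psi x) (nu x)
    + spinor_contract ((- (rc (lam x) / 2)) *: cliff R k) (psi x) (P l x).
have -> : star2 (covd1 m.1 p.1) x j
    = (rc (lam x))^-1 *: (G (j + 2%:R) (j + 1) - G (j + 1) (j + 2%:R)).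
  have AC (V : zmodType) (t u v w : V) : t - u + v - w = (t + v) - (u + w).
    by rewrite opprD addrACA addrA.
  rewrite /star2 rcV; congr (_ *: _); apply: etrans; first exact: AC.
  by congr (_ - _); exact: (cov_partial_clH1 Enu Kpsi).
rewrite /G.
have -> : lie (p.1 x j) (m.2 x)
    = (rc (lam x) / 2) *: lie (m.2 x) (spinor_contract (cliff R j) (psi x) (nu x)).
  by rewrite lieC -[RHS]opprK -scaleNr -lieZr.
rewrite (covd_clH2 Enu Kpsi j Hx) (lie_higgs_contract psi Enu _ Hx)
  (sum3_cyclic _ j) cliff_sq cliff_cyclic.
rewrite (cliff_swap R (add2_neq j)) cliff_cyclic20 opprK.
have two0 : (2 : C) != 0 by rewrite pnatr_eq0.
have lin f : linear (fun M : M2 => spinor_contract M (psi x) f).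
  by move=> c M N; rewrite contractZl contractDl.
exact: (assemble_bogomolny two0 l0 1%:M (cliff R (j + 1)) (cliff R (j + 2%:R))
  (lin (nu x)) (lin (P j x)) (lin (P (j + 1) x)) (lin (P (j + 2%:R) x))
  (bogomolny_clifford s j Hx)).
Qed.

Lemma codiff_clH1 x j : H3 x ->
  mpartial j (fun y => rc (lam y) *: p.1 y j) x + rc (lam x) *: lie (m.1 x j) (p.1 x j)
  = spinor_contract ((- rc (lam x) ^+ 3) *: (rc (x 0 j) *: cliff R j)
      + (- (rc (lam x) ^+ 3 / 4)) *: (killing_mx s x j *m cliff R j)) (psi x) (nu x)
    + spinor_contract ((- (rc (lam x) ^+ 2 / 2)) *: cliff R j) (psi x) (P j x).
Proof.
move=> Hx; have hl := has_cpartial_rc (has_partial_lam j Hx).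
have hc := has_cpartialM (has_cpartialM hl hl) (has_cpartial_cst (e_ j) x (- (1/2))).
have pE y : rc (lam y) *: p.1 y j
  = (rc (lam y) * rc (lam y) * - (1 / 2)) *: spinor_contract (cliff R j) (psi y) (nu y).
  by rewrite clH_inv1E scalerA; congr (_ *: _); field.
have pE' : (fun y => rc (lam y) *: p.1 y j) = fun y => (rc (lam y) * rc (lam y) * - (1 / 2)) *:
    spinor_contract (cliff R j) (psi y) (nu y) by apply/funext => y; apply: pE.
rewrite -lieZr pE' pE (leibniz_clH1 Enu Kpsi (cliff R j) Hx hc) scalerA.
set dc := (X in spinor_contract (X *: _ + _)); have -> : dc = - rc (lam x) ^+ 3 * rc (x 0 j).
  by rewrite /dc rcM rcX; field.
have -> : rc (lam x) * rc (lam x) * - (1 / 2) * (rc (lam x) / 2) = - (rc (lam x) ^+ 3 / 4) by field.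
by have -> : rc (lam x) * rc (lam x) * - (1 / 2) = - (rc (lam x) ^+ 2 / 2) by field.
Qed.

(** Among the terms without derivatives of nu, the multiples of X cancel because the c_l X c_l
    sum to X.  The multiples of 1 cancel because 3 e / 4 from the Killing equation and e / 4
    from the Dirac equation add up to the e in the gauge condition. *)
Lemma gauge_fixed_clH : gauge_fixed m s p.
Proof.
move=> x Hx; have l0 := rc_lam_neq0 Hx.
have two0 : (2 : C) != 0 by rewrite pnatr_eq0.
have lin f : linear (fun M : M2 => spinor_contract M (psi x) f).
  by move=> c M N; rewrite contractZl contractDl.
have kc : \sum_j killing_mx s x j *m cliff R j = (3 * killing_coef R s)%:M - 2 *: cliff_pos x.
  rewrite (eq_bigr (fun j => (killing_coef R s *: 1%:M - cliff_pos x) + rc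
    (x 0 j) *: cliff R j)); last first.
    move=> j _; rewrite /killing_mx mulmxBl mulmxDl -mulmxA cliff_sq mulmxN mulmx1.
    by rewrite mul_scalar_mx -scalemxAl cliff_sq scalerN opprK addrC addrA.
  rewrite big_split/= -[X in _ + X]/(cliff_pos x) sumr_const card_ord.
  rewrite -[_ *+ 3]scaler_nat scalerBr scalerA scalemx1 -addrA; congr (_ + _).
  by rewrite -scaleNr -[X in _ + X]scale1r -scalerDl -scaleNr; congr (_ *: _); ring.
rewrite /codiff (eq_bigr _ (fun j _ => codiff_clH1 j Hx)) clH_inv2E lieZr.
rewrite (lie_higgs_contract psi Enu _ Hx).
under [X in _ + _ *: (X + _)]eq_bigr do rewrite mul1mx.
rewrite (_ : pm R s * 2 * I_ = 2 * killing_coef R s);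
  last by rewrite /killing_coef mulrAC mulrC mulrA.
rewrite rcV rcX mul1mx.
apply: (assemble_gauge two0 l0 (cliff R) (lin (nu x)) (fun j => lin (P j x))).
rewrite big_split/= -!scaler_sumr -[\sum_i _ *: cliff R i]/(cliff_pos x) kc.
move: (rc (lam x)) (killing_coef R s) (cliff_pos x) l0 => L e X l0.
apply/matrixP => a b; rewrite !mxE !mulrb.
by move: (X a b) => d; case: (a == b); field.
Qed.
End Solution.

(** * The negative spinor bundle and the chart of the four-sphere *)

Section SpinorsOnS4.
Variable R : realType.
Implicit Types x : 'rV[R]_3.
Local Notation C := R[i].
Local Notation M2 := 'M[C]_2.
Local Notation I_ := (@Complex R 0 1).
Local Notation rc r := (@Complex R r 0).
Local Notation e_ j := (delta_mx 0 j : 'rV[R]_3).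

(** The two blocks are the components of the frame of S_- in C^2 + C^2. *)
Lemma S_minus_col th x : S_minus th x = rc (Num.sqrt (1 + nsq x))^-1 *:
  col_mx (rc (cos (th / 2)) *: cliff_pos x - (rc (sin (th / 2)))%:M)
         ((- I_) *: ((rc (cos (th / 2)))%:M + rc (sin (th / 2)) *: cliff_pos x)).
Proof.
have ii := mul_ii R.
have Gx : G1 R + \sum_j rc (x 0 j) *: Gv R j
    = block_mx (I_ *: 1%:M) (cliff_pos x) (cliff_pos x) (- I_ *: 1%:M).
  have -> : \sum_j rc (x 0 j) *: Gv R j = block_mx 0 (cliff_pos x) (cliff_pos x) 0.
    rewrite /cliff_pos !sum3E /Gv !scale_block_mx !add_block_mx !scaler0 !addr0.
    by [].
  by rewrite /G1 add_block_mx !addr0 !add0r.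
have G12 : G1 R *m G2 R = block_mx 0 (- I_)%:M (- I_)%:M 0.
  rewrite /G1 /G2 mulmx_block !mulmx0 !mul0mx !addr0 !add0r mulmxN mulmx1 -!scalemxAl.
  by rewrite !mul1mx !scalemx1 -raddfN.
rewrite /S_minus /spin_lift Gx G12 (scalar_mx_block 2 2 (1 : C)) !scale_block_mx add_block_mx.
rewrite mulmx_block !scaler0 !addr0 !add0r !scalemx1 scale_scalar_mx block_mxEh scale_row_mx
  row_mxKr; congr (_ *: _).
rewrite !mul_scalar_mx !scale_scalar_mx; congr (col_mx _ _).
  by congr (_ + _); rewrite -raddfN; congr (_%:M); ring: ii.
rewrite scalerDr addrC scale_scalar_mx scalerA.
by congr (_%:M + _ *: _); ring.
Qed.

Lemma csmooth_cospinor k U (psi : 'rV[R]_k -> 'cV[C]_2) a : open U -> msmooth_on U psi ->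
  csmooth U (fun y => cospinor (psi y) a).
Proof.
move=> oU sp; rewrite /cospinor; case: eqP => _; last exact: sp.
rewrite (_ : (fun y => _) = fun y => (-1) * psi y 1 0); last by apply/funext => y; rewrite mulN1r.
exact: (csmoothM oU (csmooth_cst oU (-1)) (sp 1 0)).
Qed.

Lemma msmooth_contract k U (M : M2) (psi : 'rV[R]_k -> 'cV[C]_2) (f : 'rV[R]_k -> 'I_2 -> M2) :
  open U -> msmooth_on U psi -> (forall b, msmooth_on U (fun y => f y b)) ->
  msmooth_on U (fun y => spinor_contract M (psi y) (f y)).
Proof.
move=> oU sp sf; apply: msmooth_on_sum => // a; apply: msmooth_on_sum => // b.
exact: (msmooth_onZ oU (csmooth_cst oU _)
  (msmooth_onZ oU (csmooth_cospinor a oU sp) (sf b))).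
Qed.

Lemma pair_smooth_clH (nu : tspinor R) psi :
  (forall a, msmooth_on (@H3 R) (fun x => nu x a)) -> msmooth_on (@H3 R) psi ->
  pair_smooth (clH_inv (tensor nu psi)).
Proof.
move=> snu spsi; have oH := @H3_open R; split=> [j|].
  rewrite (_ : (fun x => _) = fun x => (- (rc (lam x) / 2)) *: spinor_contract (cliff R j)
    (psi x) (nu x)) //.
  apply: (msmooth_onZ oH); last exact: (msmooth_contract _ oH spsi snu).
  rewrite (_ : (fun x => _) = fun x => rc (lam x) * (- (1 / 2))).
    exact: (csmoothM oH (csmooth_rc oH (smooth_lam R)) (csmooth_cst oH (- (1 / 2)))).
  by apply/funext => x; field.
rewrite (_ : (clH_inv _).2 = fun x => (1 / 2) *: spinor_contract 1%:M (psi x) (nu x)).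
  exact: (msmooth_onZ oH (csmooth_cst oH (1 / 2)) (msmooth_contract _ oH spsi snu)).
by apply/funext => x; apply: clH_inv2E.
Qed.

Lemma tr_contract (M : M2) psi f : (forall b, \tr (f b) = 0) -> \tr (spinor_contract M psi f) = 0.
Proof.
move=> tf; rewrite /spinor_contract linear_sum big1// => a _; rewrite linear_sum big1// => b _.
by rewrite /= !mxtraceZ tf !mulr0.
Qed.

Lemma conj_twistD n twop th x (X Y : M2) :
  conj_twist n twop th x (X + Y) = conj_twist n twop th x X + conj_twist n twop th x Y.
Proof.
rewrite /conj_twist; move: (twist _ _ _ _) (twist _ _ _ _) => A B.
by rewrite mulmxDr mulmxDl.
Qed.

Lemma conj_twistZ n twop th x c (X : M2) :
  conj_twist n twop th x (c *: X) = c *: conj_twist n twop th x X.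
Proof.
rewrite /conj_twist; move: (twist _ _ _ _) (twist _ _ _ _) => A B.
by rewrite -scalemxAr -scalemxAl.
Qed.

Lemma conj_twist_sum n twop th x N (F : 'I_N -> M2) :
  conj_twist n twop th x (\sum_i F i) = \sum_i conj_twist n twop th x (F i).
Proof.
rewrite /conj_twist; move: (twist _ _ _ _) (twist _ _ _ _) => A B.
by rewrite mulmx_sumr mulmx_suml.
Qed.

Lemma conj_twist_contract n twop th x (M : M2) psi f :
  conj_twist n twop th x (spinor_contract M psi f)
  = spinor_contract M psi (fun b => conj_twist n twop th x (f b)).
Proof.
rewrite /spinor_contract conj_twist_sum; apply: eq_bigr => a _.
by rewrite conj_twist_sum; apply: eq_bigr => b _; rewrite !conj_twistZ.
Qed.

Lemma conj_twist_act n twop th x k (M : 'M[C]_(k, 2)) f a :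
  conj_twist n twop th x (act_S M f a) = act_S M (fun b => conj_twist n twop th x (f b)) a.
Proof. by rewrite /act_S conj_twist_sum; apply: eq_bigr => b _; rewrite conj_twistZ. Qed.

Lemma has_partial_subV (j : 'I_3) x :
  has_partial (e_ j) (fun z => (1 + nsq z)^-1) x (- (2 * x 0 j / (1 + nsq x) ^+ 2)).
Proof.
have z0 : 1 + nsq x != 0 by rewrite lt0r_neq0// ltr_pwDl// nsq_ge0.
have h := has_partialD (has_partial_cst (e_ j) x 1) (has_partial_nsq j x).
apply: (has_partial_eq (has_partialV z0 h)) => //.
by rewrite add0r mulNr mulrC.
Qed.

Lemma has_partial_rad (j : 'I_3) x :
  has_partial (e_ j) (@Defs.rad R) x (- (4 * x 0 j / (1 + nsq x) ^+ 2)).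
Proof.
have z0 : 1 + nsq x != 0 by rewrite lt0r_neq0// ltr_pwDl// nsq_ge0.
apply: (has_partial_eq (has_partialM (has_partial_subnsq j x) (has_partial_subV j x))) => //.
by field.
Qed.

Lemma Psi_lE th x (k : 'I_2) : Psi th x 0 (lshift 3 k) = Defs.rad x * [:: cos th; sin th]`_k.
Proof. by rewrite row_mxEl !mxE. Qed.

Lemma Psi_rE th x (k : 'I_3) : Psi th x 0 (rshift 2 k) = 2 / (1 + nsq x) * x 0 k.
Proof. by rewrite row_mxEr mxE. Qed.

Lemma Psi_partial_l th x (j : 'I_3) (k : 'I_2) :
  'D_(e_ j) (fun z => Psi th z 0 (lshift 3 k)) x
  = - (4 * x 0 j / (1 + nsq x) ^+ 2) * [:: cos th; sin th]`_k.
Proof.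
have [_ <-] : has_partial (e_ j) (fun z => Psi th z 0 (lshift 3 k)) x
    (- (4 * x 0 j / (1 + nsq x) ^+ 2) * [:: cos th; sin th]`_k) => //.
apply: (has_partial_eq (has_partialM (has_partial_rad j x)
  (has_partial_cst (e_ j) x ([:: cos th; sin th]`_k)))) => [z|].
  by rewrite Psi_lE.
by rewrite mulr0 add0r mulrC.
Qed.

Lemma Psi_partial_r th x (j k : 'I_3) :
  'D_(e_ j) (fun z => Psi th z 0 (rshift 2 k)) x
  = 2 / (1 + nsq x) * (k == j)%:R - 4 * x 0 j * x 0 k / (1 + nsq x) ^+ 2.
Proof.
have [_ <-] : has_partial (e_ j) (fun z => Psi th z 0 (rshift 2 k)) x
    (2 / (1 + nsq x) * (k == j)%:R - 4 * x 0 j * x 0 k / (1 + nsq x) ^+ 2) => //.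
have z0 : 1 + nsq x != 0 by rewrite lt0r_neq0// ltr_pwDl// nsq_ge0.
apply: (has_partial_eq (has_partialM (has_partialM (has_partial_cst (e_ j) x 2)
  (has_partial_subV j x)) (has_partial_coord j k x))) => [z|].
  by rewrite Psi_rE.
by field.
Qed.

Lemma Psi_rotation_l th x (k : 'I_2) :
  derive1 (fun t => Psi t x 0 (lshift 3 k)) th = Defs.rad x * [:: - sin th; cos th]`_k.
Proof.
rewrite (_ : (fun t => _) = fun t => Defs.rad x * [:: cos t; sin t]`_k); last first.
  by apply/funext => t; rewrite Psi_lE.
elim/ord2_ind: k => /=; rewrite derive1E.
  have [_ E] := is_deriveM (is_derive_cst (Defs.rad x) th 1) (is_derive_cos th).
  by rewrite scaler0 addr0 in E; exact: E.
have [_ E] := is_deriveM (is_derive_cst (Defs.rad x) th 1) (is_derive_sin th).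
by rewrite scaler0 addr0 in E; exact: E.
Qed.

Lemma Psi_rotation_r th x (k : 'I_3) :
  derive1 (fun t => Psi t x 0 (rshift 2 k)) th = 0.
Proof.
rewrite (_ : (fun t => _) = fun t => 2 / (1 + nsq x) * x 0 k); last first.
  by apply/funext => t; rewrite Psi_rE.
by rewrite derive1E derive_cst.
Qed.
End SpinorsOnS4.

(** * Twistor spinors *)

Section TwistorAlgebra.
Variable R : realType.
Implicit Types x : 'rV[R]_3.
Local Notation C := R[i].
Local Notation M2 := 'M[C]_2.
Local Notation I_ := (@Complex R 0 1).
Local Notation rc r := (@Complex R r 0).
Local Notation e_ j := (delta_mx 0 j : 'rV[R]_3).

(** The elements a + b X form a commutative algebra, since X^2 is the scalar -|x|^2. *)
Definition cliff_lin x (a b : C) : M2 := a%:M + b *: cliff_pos x.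

Lemma cliff_linM x a b c d : cliff_lin x a b *m cliff_lin x c d
  = cliff_lin x (a * c - rc (nsq x) * b * d) (a * d + b * c).
Proof.
have sq := cliff_pos_sq x; rewrite /cliff_lin.
rewrite mulmxDl !mulmxDr -!scalemxAl -!scalemxAr sq !mul_scalar_mx !mul_mx_scalar.
move: (rc (nsq x)) (cliff_pos x) => q X.
apply/matrixP => p1 p2; rewrite !mxE !mulrb.
by move: (X p1 p2) => d0; case: (p1 == p2); ring.
Qed.

Lemma cliff_lin_cliff_pos x a b : cliff_lin x a b *m cliff_pos x
  = cliff_lin x (- (rc (nsq x) * b)) a.
Proof.
rewrite (_ : cliff_pos x = cliff_lin x 0 1); last by rewrite /cliff_lin raddf0 add0r scale1r.
by rewrite cliff_linM; congr cliff_lin; ring.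
Qed.

(** Moving c_j to the right: c_j X = - 2 x_j - X c_j. *)
Lemma cliff_lin_cliff x a b c d j : cliff_lin x a b *m cliff R j *m cliff_lin x c d
  = cliff_lin x (- (2 * rc (x 0 j) * d * a)) (- (2 * rc (x 0 j) * d * b))
    + cliff_lin x (a * c + b * d * rc (nsq x)) (b * c - a * d) *m cliff R j.
Proof.
have cX : cliff R j *m cliff_pos x = (- (2 * rc (x 0 j)))%:M - cliff_pos x *m cliff R j.
  by rewrite -cliff_pos_anticomm addrC addKr.
have E : cliff R j *m cliff_lin x c d = (- (2 * rc (x 0 j) * d))%:M + cliff_lin x c
  (- d) *m cliff R j.
  rewrite /cliff_lin mulmxDr mul_mx_scalar -scalemxAr cX mulmxDl mul_scalar_mx -scalemxAl.
  rewrite scalerBr scale_scalar_mx scaleNr addrCA; congr (_%:M + _).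
  by ring.
rewrite -mulmxA E mulmxDr mulmxA cliff_linM mul_mx_scalar; congr (_ + cliff_lin x _ _ *m _).
- by rewrite /cliff_lin scalerDr scale_scalar_mx scalerA; congr (_%:M + _ *: _); ring.
- by ring.
- by ring.
Qed.

Lemma cliff_linZ x k a b : k *: cliff_lin x a b = cliff_lin x (k * a) (k * b).
Proof. by rewrite /cliff_lin scalerDr scale_scalar_mx scalerA. Qed.

Lemma cliff_linD x a b c d : cliff_lin x a b + cliff_lin x c d = cliff_lin x (a + c) (b + d).
Proof. by rewrite /cliff_lin addrACA -raddfD -scalerDl. Qed.

(** The scalar in front of the frame of S_-, rewritten with the only half-integral power
    (1 - |x|^2)^(-1/2), which Killing spinors also carry. *)
Definition minus_weight s x th : C := rc (conf_isqrt x * (1 + nsq x) / (1 - nsq x)) *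
  (rc (cos (th / 2)) + killing_coef R s * rc (sin (th / 2))).

(** This is r_1^(-3/2) = r_1^(-1) r_1^(-1/2) together with r_1 = (1 - |x|^2) / (1 + |x|^2). *)
Lemma spin_weight_sqrt s th x : H3 x ->
  spin_weight s th x * rc (Num.sqrt (1 + nsq x))^-1 = minus_weight s x th.
Proof.
move=> Hx; have h0 := H3_gt0 Hx.
have z0 : 0 < 1 + nsq x by rewrite ltr_pwDl// nsq_ge0.
rewrite /spin_weight /minus_weight mulrAC -rcM; congr (_ * _).
  congr (rc _); rewrite /Defs.rad /conf_isqrt.
  have r0 : 0 < (1 - nsq x) / (1 + nsq x) by rewrite divr_gt0.
  rewrite powRN (_ : 3 / 2 = 1 + 2^-1 :> R); last by field.
  rewrite powRD; last by rewrite gt_eqF// implybT.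
  rewrite powRr1 ?ltW// powR12_sqrt ?ltW// sqrtrM ?ltW// sqrtrV ?ltW//.
  have := sqrtr_gt0 (1 - nsq x); rewrite h0 => /lt0r_neq0 s0.
  have := sqrtr_gt0 (1 + nsq x); rewrite z0 => /lt0r_neq0 t0.
  move: (Num.sqrt _) (Num.sqrt _) s0 t0 (lt0r_neq0 h0) (lt0r_neq0 z0) => a b a0 b0 c0 d0.
  by field; rewrite a0 b0 c0 d0.
apply/eqP; rewrite eq_complex /killing_coef /pm; apply/andP; case: s => /=; split; apply/eqP; ring.
Qed.

Lemma cos_half (th : R) : cos th = cos (th / 2) ^+ 2 - sin (th / 2) ^+ 2.
Proof. by rewrite [in LHS](splitr th) cosD !expr2. Qed.

Lemma sin_half (th : R) : sin th = 2 * (sin (th / 2) * cos (th / 2)).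
Proof. by rewrite [in LHS](splitr th) sinD; ring. Qed.

(** [twistor_up] and [twistor_dn] send a constant spinor c to the two components in C^2 + C^2
    of the twistor spinor that restricts to the Killing spinor psi with psi(0) = c.  Its value
    on S^4 is r_1^(1/2) e^(-/+ i theta / 2) times the image of psi in S_+; the half-angles
    cancel, and the result is affine in y. *)
Definition twistor_up s (y : 'rV[R]_(2 + 3)) : M2 :=
  (1 / 2) *: cliff_lin (rsubmx y)
     (I_ * (1 + rc (y 0 (lshift 3 0))) + pm R s * rc (y 0 (lshift 3 1))) (- pm R s).

Definition twistor_dn s (y : 'rV[R]_(2 + 3)) : M2 :=
  (1 / 2) *: cliff_lin (rsubmx y)
     (killing_coef R s * (rc (y 0 (lshift 3 0)) - 1) + rc (y 0 (lshift 3 1))) 1.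

Lemma cliff_posZ x (k : R) : cliff_pos (k *: x) = rc k *: cliff_pos x.
Proof. by rewrite /cliff_pos scaler_sumr; apply: eq_bigr => j _; rewrite mxE rcM scalerA. Qed.

Lemma tr_cliff_pos x : \tr (cliff_pos x) = 0.
Proof. by rewrite /cliff_pos linear_sum big1// => j _; rewrite /= mxtraceZ tr_cliff mulr0. Qed.

Lemma adj_cliff_lin x a b : (\tr (cliff_lin x a b))%:M - cliff_lin x a b = cliff_lin x a (- b).
Proof.
rewrite /cliff_lin mxtraceD mxtraceZ tr_cliff_pos mulr0 addr0 mxtrace_scalar opprD addrA
  -raddfB scaleNr.
by congr (_%:M - _); rewrite mulr2n addrK.
Qed.

(** The component k is minus one half of B (t, Gamma_k F), where t = (u, d) is the twistor
    spinor, Gamma_k is the action of the k-th basis vector of R^5, and B is the invariant skew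
    form eps + (- eps) on C^2 + C^2. *)
Definition extension_form s (c : 'cV[C]_2) (F : 'rV[R]_(2 + 3) -> 'I_(2 + 2) -> M2)
    (y : 'rV[R]_(2 + 3)) (k : 'I_(2 + 3)) : M2 :=
  let u := twistor_up s y *m c in let d := twistor_dn s y *m c in
  let fu := fun b : 'I_2 => F y (lshift 2 b) in
  let fd := fun b : 'I_2 => F y (rshift 2 b) in
  match fintype.split k with
  | inl i => if i == 0
      then (- (1 / 2)) *: (spinor_contract (I_%:M) u fu + spinor_contract (I_%:M) d fd)
      else (1 / 2) *: (spinor_contract 1%:M u fd + spinor_contract 1%:M d fu)
  | inr j => (- (1 / 2)) *:
      (spinor_contract (cliff R j) u fd + (-1) *: spinor_contract (cliff R j) d fu)
  end.

Lemma csmooth_coord k (U : set 'rV[R]_k) j : open U -> csmooth U (fun y => rc (y 0 j)).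
Proof. by move=> oU; apply: csmooth_rc => //; apply: smooth_alg_coord. Qed.

Lemma msmooth_mulmx_cst k (U : set 'rV[R]_k) (M : 'rV[R]_k -> M2) (c : 'cV[C]_2) : open U ->
  msmooth_on U M -> msmooth_on U (fun y => M y *m c).
Proof.
move=> oU sM a b; rewrite -/(csmooth U (fun y => (M y *m c) a b)).
rewrite (_ : (fun y => _) = fun y => \sum_i M y a i * c i b); last first.
  by apply/funext => y; rewrite mxE.
by apply: csmooth_sum => // i; exact: (csmoothM oU (sM a i) (csmooth_cst oU _)).
Qed.

Lemma msmooth_cst k U a b (M : 'M[C]_(a, b)) : open U -> msmooth_on U (fun _ : 'rV[R]_k => M).
Proof. by move=> oU p q; exact: (csmooth_cst oU (M p q)). Qed.

Lemma msmooth_cliff_lin U (a : 'rV[R]_(2 + 3) -> C) b : open U -> csmooth U a ->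
  msmooth_on U (fun y => (1 / 2) *: cliff_lin (rsubmx y) (a y) b).
Proof.
move=> oU sa; apply: (msmooth_onZ oU (csmooth_cst oU _)).
rewrite /cliff_lin; apply: (msmooth_onD oU).
  rewrite (_ : (fun y => _) = fun y => a y *: 1%:M); last first.
    by apply/funext => y; rewrite scalemx1.
  exact: (msmooth_onZ oU sa (msmooth_cst _ oU)).
apply: (msmooth_onZ oU (csmooth_cst oU _)); rewrite /cliff_pos.
apply: (msmooth_on_sum oU) => j; apply: (msmooth_onZ oU); last exact: msmooth_cst.
rewrite (_ : (fun y : 'rV[R]_(2 + 3) => _) = fun y : 'rV[R]_(2 + 3) => rc (y 0 (rshift 2 j)));
  first exact: csmooth_coord.
by apply/funext => y; rewrite mxE.
Qed.

Lemma msmooth_extension s c F U : open U -> (forall i, msmooth_on U (fun y => F y i)) ->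
  forall k, msmooth_on U (fun y => extension_form s c F y k).
Proof.
move=> oU sF k; rewrite /extension_form.
have cst a := csmooth_cst (k := 2 + 3) oU a.
have s0 := csmooth_coord (lshift 3 0 : 'I_(2 + 3)) oU.
have s1 := csmooth_coord (lshift 3 1 : 'I_(2 + 3)) oU.
have su : msmooth_on U (fun y => twistor_up s y *m c).
  apply: msmooth_mulmx_cst => //; apply: (msmooth_cliff_lin _ oU).
  exact: (csmoothD oU (csmoothM oU (cst _) (csmoothD oU (cst _) s0)) (csmoothM oU (cst _) s1)).
have sd : msmooth_on U (fun y => twistor_dn s y *m c).
  apply: msmooth_mulmx_cst => //; apply: (msmooth_cliff_lin _ oU).
  exact: (csmoothD oU (csmoothM oU (cst _) (csmoothD oU s0 (cst _))) s1).
have sfu b : msmooth_on U (fun y => F y (lshift 2 b)) by [].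
have sfd b : msmooth_on U (fun y => F y (rshift 2 b)) by [].
case: (fintype.split k) => [i|j]; last first.
  exact: (msmooth_onZ oU (cst _) (msmooth_onD oU (msmooth_contract _ oU su sfd)
    (msmooth_onZ oU (cst _) (msmooth_contract _ oU sd sfu)))).
by case: (i == 0); exact: (msmooth_onZ oU (cst _) (msmooth_onD oU
  (msmooth_contract _ oU su _) (msmooth_contract _ oU sd _))).
Qed.
End TwistorAlgebra.

(** * Extension over the sphere at infinity *)

Section Extension.
Variable R : realType.
Implicit Types x : 'rV[R]_3.
Local Notation C := R[i].
Local Notation M2 := 'M[C]_2.
Local Notation I_ := (@Complex R 0 1).
Local Notation rc r := (@Complex R r 0).
Local Notation e_ j := (delta_mx 0 j : 'rV[R]_3).

Lemma cliff_lin_scale x k a b : cliff_lin (k *: x) a b = cliff_lin x a (b * rc k).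
Proof. by rewrite /cliff_lin cliff_posZ scalerA. Qed.

Lemma twistor_up_Psi s th x : twistor_up s (Psi th x) = cliff_lin x
  ((I_ * (1 + rc (Defs.rad x * cos th)) + pm R s * rc (Defs.rad x * sin th)) / 2)
  (- (pm R s * rc (1 + nsq x)^-1)).
Proof.
rewrite /twistor_up !Psi_lE/= /Psi row_mxKr cliff_lin_scale cliff_linZ.
by congr cliff_lin; [rewrite mulrC mul1r|rewrite !rcM rc_nat; field].
Qed.

Lemma twistor_dn_Psi s th x : twistor_dn s (Psi th x) = cliff_lin x
  ((killing_coef R s * (rc (Defs.rad x * cos th) - 1) + rc (Defs.rad x * sin th)) / 2)
  (rc (1 + nsq x)^-1).
Proof.
rewrite /twistor_dn !Psi_lE/= /Psi row_mxKr cliff_lin_scale cliff_linZ.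
by congr cliff_lin; [rewrite mulrC mul1r|rewrite !rcM rc_nat; field].
Qed.

(** The adjoint of a + b X for the pairing of spinors is a - b X. *)
Lemma contract_cliff_lin (M N : M2) x a b (c : 'cV[C]_2) f :
  spinor_contract M (cliff_lin x a b *m c) (act_S N f)
  = spinor_contract (cliff_lin x a (- b) *m M *m N) c f.
Proof. by rewrite contract_act contract_mulmx adj_cliff_lin mulmxA. Qed.

Lemma killing_cliff_lin s psi x : killing s psi -> H3 x ->
  psi x = cliff_lin x (rc (conf_isqrt x)) (rc (conf_isqrt x) * killing_coef R s) *m psi 0.
Proof.
move=> K Hx; rewrite (killing_formula K Hx) -[1%:M + _]/(cliff_lin x 1 (killing_coef R s)).
by rewrite scalemxAl cliff_linZ mulr1.
Qed.

(** Normal form for the products (a + b X) c_j (c + d X). *)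
Definition cliff_quad x j (a b c d : C) : M2 := cliff_lin x a b + cliff_lin x c d *m cliff R j.

Lemma quadD x j a b c d a' b' c' d' :
  cliff_quad x j a b c d + cliff_quad x j a' b' c' d'
    = cliff_quad x j (a + a') (b + b') (c + c') (d + d').
Proof. by rewrite /cliff_quad addrACA cliff_linD -mulmxDl cliff_linD. Qed.

Lemma quad_congr x j a b c d a' b' c' d' psi f :
  a = a' -> b = b' -> c = c' -> d = d' ->
  spinor_contract (cliff_quad x j a b c d) psi f
    = spinor_contract (cliff_quad x j a' b' c' d') psi f.
Proof. by move=> -> -> -> ->. Qed.

Lemma quadZ x j k a b c d :
  k *: cliff_quad x j a b c d = cliff_quad x j (k * a) (k * b) (k * c) (k * d).
Proof. by rewrite /cliff_quad scalerDr cliff_linZ scalemxAl cliff_linZ. Qed.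

Lemma quad_lin x j a b : cliff_lin x a b = cliff_quad x j a b 0 0.
Proof. by rewrite /cliff_quad (_ : cliff_lin x 0 0
  = 0) ?mul0mx ?addr0// /cliff_lin raddf0 scale0r addr0. Qed.

Lemma quad_cliff x j a b : cliff_lin x a b *m cliff R j = cliff_quad x j 0 0 a b.
Proof. by rewrite /cliff_quad (_ : cliff_lin x 0 0
  = 0) ?add0r// /cliff_lin raddf0 scale0r addr0. Qed.

Lemma quad_sandwich x j a b k l c d :
  cliff_lin x a b *m (k *: cliff R j + l *: cliff_pos x) *m cliff_lin x c d
  = cliff_quad x j (- (2 * k * rc (x 0 j) * d * a) - l * rc (nsq x) * (a * d + b * c))
             (- (2 * k * rc (x 0 j) * d * b) + l * (a * c - rc (nsq x) * b * d))
             (k * (a * c + b * d * rc (nsq x))) (k * (b * c - a * d)).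
Proof.
have bil (A B D E : M2) :
    A *m (k *: D + l *: E) *m B = k *: (A *m D *m B) + l *: (A *m E *m B).
  by rewrite mulmxDr mulmxDl -!scalemxAr -!scalemxAl.
rewrite bil cliff_lin_cliff cliff_lin_cliff_pos cliff_linM.
rewrite scalerDr scalemxAl !cliff_linZ addrAC cliff_linD /cliff_quad.
by congr (cliff_lin x _ _ + _); ring.
Qed.

Lemma contract_collapse N (k : 'I_N -> C) (M : 'I_N -> M2) a b c d f g :
  \sum_l k l *: (a *: (spinor_contract (M l) c f + b *: spinor_contract (M l) d g))
  = a *: (spinor_contract (\sum_l k l *: M l) c f + b *: spinor_contract (\sum_l k l *: M l) d g).
Proof.
rewrite -!contract_suml scaler_sumr -big_split scaler_sumr; apply: eq_bigr => l _ /=.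
rewrite -!contractZl !scalerDr !scalerA.
move: (spinor_contract _ _ _) (spinor_contract _ _ _) => S T.
by congr (_ *: _ + _ *: _); ring.
Qed.

Variables (n twop : nat) (s : bool) (nu : tspinor R) (psi : spinor R).
Hypothesis Kpsi : killing s psi.
Variables (th : R) (x : 'rV[R]_3) (F : 'rV[R]_(2 + 3) -> 'I_(2 + 2) -> M2).
Hypothesis Hx : H3 x.
Hypothesis HF : forall i, F (Psi th x) i = conj_twist n twop th x
  (act_S (S_minus th x) (fun b => spin_weight s th x *: nu x b) i).
Let f b := conj_twist n twop th x (nu x b).
Let p := clH_inv (tensor nu psi).
Let w := minus_weight s x th.
Let co := rc (cos (th / 2)).
Let si := rc (sin (th / 2)).

(** The twist by the circle action is linear on End (V), so it only changes nu into f. *)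
Lemma minus_spinor_up : (fun b => F (Psi th x) (lshift 2 b))
  = act_S (cliff_lin x (- (w * si)) (w * co)) f.
Proof.
apply/funext => b; rewrite HF conj_twist_act /act_S; apply: eq_bigr => b' _.
rewrite conj_twistZ scalerA; congr (_ *: _).
rewrite S_minus_col mxE col_mxEu /w -(spin_weight_sqrt s th Hx) -/co -/si.
have -> : co *: cliff_pos x - si%:M = cliff_lin x (- si) co.
  by rewrite /cliff_lin raddfN addrC.
move: (spin_weight s th x) => w0; set r := rc (Num.sqrt _)^-1.
rewrite -mulrN -cliff_linZ [RHS]mxE; move: (cliff_lin _ _ _ _ _) => d.
by rewrite mulrAC [w0 * r]mulrC.
Qed.

Lemma minus_spinor_dn : (fun b => F (Psi th x) (rshift 2 b))
  = act_S (cliff_lin x (- (w * I_ * co)) (- (w * I_ * si))) f.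
Proof.
apply/funext => b; rewrite HF conj_twist_act /act_S; apply: eq_bigr => b' _.
rewrite conj_twistZ scalerA; congr (_ *: _).
rewrite S_minus_col mxE col_mxEd /w -(spin_weight_sqrt s th Hx) -/co -/si.
rewrite -[X in - I_ *: X]/(cliff_lin x co si) cliff_linZ.
move: (spin_weight s th x) => w0; set r := rc (Num.sqrt _)^-1.
rewrite (_ : cliff_lin x (- (w0 * r * I_ * co)) _
  = (w0 * r) *: cliff_lin x (- I_ * co) (- I_ * si)).
  by rewrite [RHS]mxE; move: (cliff_lin _ _ _ _ _) => d; rewrite mulrAC [w0 * r]mulrC.
by rewrite cliff_linZ; congr cliff_lin; ring.
Qed.

Let Q := rc (nsq x).
Let H := rc (conf_isqrt x).

Lemma Q_neq1 : 1 - Q != 0.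
Proof. by rewrite -[1]/(rc 1) /Q -rcN -rcD rc_eq0 lt0r_neq0// H3_gt0. Qed.

Lemma Q_neqN1 : 1 + Q != 0.
Proof. by rewrite -[1]/(rc 1) /Q -rcD rc_eq0 lt0r_neq0// ltr_pwDl// nsq_ge0. Qed.

Lemma rc1D : rc (1 + nsq x) = 1 + Q. Proof. by rewrite rcD. Qed.
Lemma rc1B : rc (1 - nsq x) = 1 - Q. Proof. by rewrite rcD rcN. Qed.
Lemma rc_rad : rc (Defs.rad x) = (1 - Q) / (1 + Q).
Proof. by rewrite /Defs.rad rcM rcV rc1D rc1B. Qed.
Lemma wE : w = H * (1 + Q) / (1 - Q) * (co + killing_coef R s * si).
Proof. by rewrite /w /minus_weight !rcM rcV rc1D rc1B. Qed.
Lemma rc_cos : rc (cos th) = co * co - si * si.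
Proof. by rewrite cos_half rcD rcN !expr2 !rcM. Qed.
Lemma rc_sin : rc (sin th) = 2 * (si * co).
Proof. by rewrite sin_half !rcM rc_nat. Qed.
Lemma cos_sin : si * si = 1 - co * co.
Proof. by rewrite /si /co -!rcM -!expr2 sin2cos2 rcD rcN. Qed.

(** Only the directions y_1, y_2 move with theta.  Both sides are contractions of psi(0)
    with f through elements a + b X, and the coefficients agree. *)
Lemma extension_dtheta : conj_twist n twop th x (p.2 x)
  = \sum_k rc (derive1 (fun t => Psi t x 0 k) th)
      *: extension_form s (psi 0) F (Psi th x) k.
Proof.
rewrite clH_inv2E conj_twistZ conj_twist_contract (killing_cliff_lin Kpsi Hx).
rewrite contract_mulmx adj_cliff_lin mulmx1 contractZl cliff_linZ.
rewrite big_split_ord/= [X in _ + X]big1 => [|k _]; last first.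
  by rewrite /= Psi_rotation_r scale0r.
rewrite addr0 sum2E /= !Psi_rotation_l /= /extension_form.
have sl i : fintype.split (lshift 3 i) = inl i :> 'I_2 + 'I_3 by exact: (unsplitK (inl i)).
rewrite !sl /= minus_spinor_up minus_spinor_dn twistor_up_Psi twistor_dn_Psi !contract_cliff_lin.
have scal x0 a b k : cliff_lin x0 a b *m k%:M = cliff_lin x0 (a * k) (b * k).
  by rewrite mul_mx_scalar cliff_linZ ![_ * k]mulrC.
rewrite !scal !cliff_linM !contractDl !contractZl !cliff_linD !cliff_linZ !contractDl cliff_linD.
rewrite !(rcM (Defs.rad x)) (rcN (sin th)) rc_sin rc_cos rc_rad rcV rc1D wE -/Q -/H.
have ii := mul_ii R; have cs := cos_sin; have q1 := Q_neq1; have q2 := Q_neqN1.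
move: Q H co si cs q1 q2 => q h a b cs q1 q2.
congr (spinor_contract (cliff_lin _ _ _) _ _); rewrite /killing_coef /pm; case: s.
all: by field: ii cs; rewrite q1 q2.
Qed.
Lemma rc_lam : rc (lam x) = 2 / (1 - Q).
Proof. by rewrite /lam rcM rcV rc1B rc_nat. Qed.

(** The same comparison, now between elements of the form (a + b X) + (c + d X) c_j. *)
Lemma extension_dx j : conj_twist n twop th x (p.1 x j)
  = \sum_k rc ('D_(e_ j) (fun z => Psi th z 0 k) x)
      *: extension_form s (psi 0) F (Psi th x) k.
Proof.
rewrite clH_inv1E conj_twistZ conj_twist_contract (killing_cliff_lin Kpsi Hx).
rewrite contract_mulmx adj_cliff_lin contractZl quad_cliff quadZ.
rewrite big_split_ord/= sum2E /= !Psi_partial_l /= /extension_form.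
have sl i : fintype.split (lshift 3 i) = inl i :> 'I_2 + 'I_3 by exact: (unsplitK (inl i)).
have sr i : fintype.split (rshift 2 i) = inr i :> 'I_2 + 'I_3 by exact: (unsplitK (inr i)).
rewrite !sl /=.
under [X in _ = _ + X]eq_bigr do rewrite sr Psi_partial_r.
rewrite contract_collapse.
have -> : \sum_l rc (2 / (1 + nsq x) * (l == j)%:R - 4 * x 0 j * x 0 l / (1 + nsq x) ^+ 2)
      *: cliff R l
    = (2 / (1 + Q)) *: cliff R j + (- (4 * rc (x 0 j) / (1 + Q) ^+ 2)) *: cliff_pos x.
  rewrite /cliff_pos scaler_sumr (bigD1 j)//= [in RHS](bigD1 j)//= addrA; congr (_ + _).
    rewrite eqxx scalerA -scalerDl; congr (_ *: _).
    by rewrite rcD rcN !rcM !rcV rcX rc1D !rc_nat mulr1 mulNr; congr (_ - _); rewrite mulrAC.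
  apply: eq_bigr => l /negPf ->; rewrite scalerA; congr (_ *: _).
  by rewrite mulr0 sub0r rcN !rcM rcV rcX rc1D !rc_nat mulNr; congr (- _); rewrite mulrAC.
rewrite minus_spinor_up minus_spinor_dn twistor_up_Psi twistor_dn_Psi !contract_cliff_lin
  !quad_sandwich.
have scal x0 a b k : cliff_lin x0 a b *m k%:M = cliff_lin x0 (a * k) (b * k).
  by rewrite mul_mx_scalar cliff_linZ ![_ * k]mulrC.
rewrite !scal !cliff_linM !(quad_lin x j).
rewrite !contractZl !contractDl !contractZl !contractDl.
rewrite !quadZ !quadD !quadZ !quadD.
have rcY (y : R) : rc (- (4 * x 0 j / (1 + nsq x) ^+ 2) * y)
    = - (4 * rc (x 0 j) / (1 + Q) ^+ 2) * rc y.
  by rewrite (rcM _ y) rcN (rcM _ _^-1) rcM rcV rcX rc1D rc_nat.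
rewrite !rcY !(rcM (Defs.rad x)) rc_sin rc_cos rc_rad rc_lam rcV rc1D wE -/Q -/H.
have ii := mul_ii R; have cs := cos_sin; have q1 := Q_neq1; have q2 := Q_neqN1.
move: Q H co si cs q1 q2 (rc (x 0 j)) => q h a b cs q1 q2 xj.
(* The coefficients of 1 and X vanish; those of c_j and X c_j give the left-hand side. *)
apply: quad_congr; rewrite /killing_coef /pm; case: s.
all: by field: ii cs; rewrite q1 q2.
Qed.
End Extension.

(** * Classes of tangent pairs *)

Section TangentSpace.
Variable R : realType.
Implicit Types (p q : hpair R) (c : R[i]) (x : 'rV[R]_3).
Local Notation C := R[i].
Local Notation M2 := 'M[C]_2.
Local Notation I_ := (@Complex R 0 1).
Local Notation rc r := (@Complex R r 0).
Local Notation e_ j := (delta_mx 0 j : 'rV[R]_3).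
Variables (n twop : nat) (m : hpair R).

(** The neighbourhood and the smooth spinor given for nu also serve for the 1-form. *)
Lemma clH_form_extends s nu psi : eigenspinor n twop m s nu -> killing s psi ->
  form_extends n twop (clH_inv (tensor nu psi)).
Proof.
move=> [_ _ _ [U [F [oU S2U sF EF]]]] K.
exists U, (extension_form s (psi 0) F); split => //; first exact: msmooth_extension.
move=> th x Hx x0 Ux.
have HF i := EF th x i Hx x0 Ux.
split; first exact: (extension_dtheta K Hx HF).
by move=> j; apply: (extension_dx K Hx HF).
Qed.

Lemma clH_tangent s nu psi : eigenspinor n twop m s nu -> killing s psi ->
  tangent_pair n twop m (clH_inv (tensor nu psi)).
Proof.
move=> E K; have [snu tnu _ _] := E; split.
- by apply: pair_smooth_clH => //; case: K.
- move=> x Hx; split=> [j|].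
    by rewrite clH_inv1E mxtraceZ tr_contract ?mulr0// => b; apply: tnu.
  by rewrite clH_inv2E mxtraceZ tr_contract ?mulr0// => b; apply: tnu.
- by move=> x j Hx; apply: (linearised_bogomolny E K).
- exact: (clH_form_extends E K).
Qed.

Lemma mpartial_lin k (U : set 'rV[R]_k) (F G : 'rV[R]_k -> M2) c (j : 'I_k) y :
  msmooth_on U F -> msmooth_on U G -> U y ->
  mpartial j (fun z => c *: F z + G z) y = c *: mpartial j F y + mpartial j G y.
Proof.
move=> sF sG Uy; have hF := msmooth_has_mpartial j sF Uy.
have hG := msmooth_has_mpartial j sG Uy.
rewrite (mpartial_eq (has_mpartialD
  (has_mpartialZ (has_cpartial_cst (delta_mx 0 j) y c) hF) hG)).
by rewrite scale0r addr0.
Qed.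

Lemma lie_lin (A X Y : M2) c : lie A (c *: X + Y) = c *: lie A X + lie A Y.
Proof. by rewrite lieDr lieZr. Qed.

Lemma lie_linl (A X Y : M2) c : lie (c *: X + Y) A = c *: lie X A + lie Y A.
Proof. by rewrite lieC lie_lin opprD -scalerN -!lieC. Qed.

Lemma form_extends_lin c p q : form_extends n twop p -> form_extends n twop q ->
  form_extends n twop (padd (pscale c p) q).
Proof.
move=> [U [F [oU SU sF EF]]] [V [G [oV SV sG EG]]].
exists (U `&` V), (fun y k => c *: F y k + G y k); split.
- exact: openI.
- by move=> y Sy; split; [apply: SU|apply: SV].
- move=> k; have oUV := openI oU oV; apply: (msmooth_onD oUV).
    apply: (msmooth_onZ oUV (csmooth_cst oUV c)) => a b.
    by split=> t y [Uy _]; have [h1 h2] := sF k a b; [apply: h1|apply: h2].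
  move=> a b.
  by split=> t y [_ Vy]; have [h1 h2] := sG k a b; [apply: h1|apply: h2].
- move=> th x Hx x0 [Ux Vx]; have [p0 pj] := EF th x Hx x0 Ux.
  have [q0 qj] := EG th x Hx x0 Vx; split=> [|j].
    rewrite /= conj_twistD conj_twistZ p0 q0 scaler_sumr -big_split; apply: eq_bigr => k _.
    by rewrite /= scalerDr !scalerA [c * _]mulrC.
  rewrite /= conj_twistD conj_twistZ pj qj scaler_sumr -big_split; apply: eq_bigr => k _.
  by rewrite /= scalerDr !scalerA [c * _]mulrC.
Qed.

Lemma covd_lin (A : oneform R) (f g : mfield R) c x j :
  msmooth_on (@H3 R) f -> msmooth_on (@H3 R) g -> H3 x ->
  covd A (fun y => c *: f y + g y) x j = c *: covd A f x j + covd A g x j.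
Proof.
move=> sf sg Hx; rewrite /covd (mpartial_lin c j sf sg Hx) lie_lin.
move: (mpartial j f x) (mpartial j g x) (lie _ _) (lie _ _) => a b a' b'.
by rewrite scalerDr addrACA.
Qed.

Lemma covd1_lin (A a b : oneform R) c x j :
  (forall j, msmooth_on (@H3 R) (fun y => a y j)) ->
  (forall j, msmooth_on (@H3 R) (fun y => b y j)) -> H3 x ->
  covd1 A (fun y k => c *: a y k + b y k) x j = c *: covd1 A a x j + covd1 A b x j.
Proof.
move=> sa sb Hx; rewrite /covd1 !lie_lin.
rewrite (mpartial_lin c (j + 1) (sa (j + 2%:R)) (sb (j + 2%:R)) Hx).
rewrite (mpartial_lin c (j + 2%:R) (sa (j + 1)) (sb (j + 1)) Hx).
move: (mpartial (j + 1) _ x) (mpartial (j + 1) _ x) => a1 b1.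
move: (mpartial (j + 2%:R) _ x) (mpartial (j + 2%:R) _ x) => a2 b2.
move: (lie _ _) (lie _ _) (lie _ _) (lie _ _) => a3 b3 a4 b4.
by rewrite !opprD !scalerDr !scalerN !addrA [LHS](ACl (1*3*5*7*2*4*6*8)%AC).
Qed.

Lemma tangent_lin c p q : tangent_pair n twop m p -> tangent_pair n twop m q ->
  tangent_pair n twop m (padd (pscale c p) q).
Proof.
have oH := @H3_open R; have cc := csmooth_cst oH c.
move=> [[sp1 sp2] tp Ep fp] [[sq1 sq2] tq Eq fq]; split.
- split=> [j|]; [have h1 := sp1 j; have h2 := sq1 j|].
    exact: (msmooth_onD oH (msmooth_onZ oH cc h1) h2).
  exact: (msmooth_onD oH (msmooth_onZ oH cc sp2) sq2).
- move=> x Hx; have [tp1 tp2] := tp x Hx; have [tq1 tq2] := tq x Hx.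
  by split=> [j|]; rewrite /= mxtraceD mxtraceZ ?tp1 ?tq1 ?tp2 ?tq2 mulr0 addr0.
- move=> x j Hx; rewrite /star2 /= (covd_lin _ _ _ sp2 sq2 Hx) (covd1_lin _ _ _ sp1 sq1 Hx).
  have := Eq x j Hx; have := Ep x j Hx; rewrite /star2 lie_linl.
  move: (covd _ p.2 x j) (covd _ q.2 x j) (covd1 _ _ _ _) (covd1 _ _ _ _) => a b a1 b1.
  move: (lie (p.1 x j) (m.2 x)) (lie (q.1 x j) (m.2 x)) => a2 b2 Ea Eb.
  by rewrite addrACA -scalerDr Ea Eb scalerDr !scalerA [_ * c]mulrC.
- exact: form_extends_lin.
Qed.

Lemma gauge_fixed_lin s c p q : tangent_pair n twop m p -> tangent_pair n twop m q ->
  gauge_fixed m s p -> gauge_fixed m s q -> gauge_fixed m s (padd (pscale c p) q).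
Proof.
have oH := @H3_open R; have sl := csmooth_rc oH (smooth_lam R).
move=> [[sp1 _] _ _ _] [[sq1 _] _ _ _] gp gq x Hx.
have -> : codiff m.1 (padd (pscale c p) q).1 x = c *: codiff m.1 p.1 x + codiff m.1 q.1 x.
  rewrite /codiff scalerA [c * _]mulrC -scalerA -scalerDr; congr (_ *: _).
  rewrite scaler_sumr -big_split/=; apply: eq_bigr => j _.
  rewrite (_ : (fun y => rc (lam y) *: (c *: p.1 y j + q.1 y j))
    = fun y => c *: (rc (lam y) *: p.1 y j) + rc (lam y) *: q.1 y j); last first.
    by apply/funext => y; rewrite scalerDr !scalerA [c * _]mulrC.
  rewrite (mpartial_lin c j (msmooth_onZ oH sl (sp1 j)) (msmooth_onZ oH sl (sq1 j)) Hx).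
  rewrite lie_lin; move: (lie _ _) (lie _ _) (mpartial _ _ _) (mpartial _ _ _) => a b a1 b1.
  by rewrite !scalerDr !scalerA [c * _]mulrC addrACA.
have comb (a b a1 b1 a2 b2 : M2) (k : C) : a + a1 + k *: a2 = 0 -> b + b1 + k *: b2 = 0 ->
    (c *: a + b) + (c *: a1 + b1) + k *: (c *: a2 + b2) = 0.
  rewrite addrACA -scalerDr [k *: (_ + _)]scalerDr [k *: (c *: _)]scalerA [k * c]mulrC.
  by rewrite -scalerA addrACA -scalerDr => -> ->; rewrite scaler0 addr0.
by rewrite /= lie_lin; apply: comb; [apply: gp|apply: gq].
Qed.

Local Notation mu1 := (@lebesgue_measure R).
Local Notation mu3 := ((mu1 \x mu1) \x mu1)%E.

Lemma eq_int_coord (f g : 'rV[R]_3 -> C) : (forall x, H3 x -> f x = g x) ->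
  int_coord f = int_coord g.
Proof.
move=> fg; rewrite /int_coord; congr Complex; apply: eq_Rintegral => t /set_mem Ht;
  by rewrite fg.
Qed.

Lemma int_coord0 : int_coord (fun _ : 'rV[R]_3 => 0 : C) = 0.
Proof.
by rewrite /int_coord /Rintegral /=; congr Complex; rewrite integral0.
Qed.

(** The zero gauge transformation relates p to itself. *)
Lemma tclass_refl p : tangent_pair n twop m p -> tclass n twop m p p.
Proof.
move=> tp; have oH := @H3_open R.
have mp0 j x : mpartial j (fun=> 0 : M2) x = 0 :> M2.
  by apply: mpartial_eq => a b; rewrite !mxE; apply: has_cpartial_cst.
have l0 (X : M2) : lie X 0 = 0 by rewrite /lie mulmx0 mul0mx subr0.
have c0 x j : covd m.1 (fun=> 0) x j = 0 by rewrite /covd mp0 l0 addr0.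
split=> //; exists (fun=> 0); last by move=> x Hx; rewrite l0 addr0; split=> // j; rewrite c0 addr0.
split.
- exact: msmooth_cst.
- by move=> x Hx; rewrite mxtrace0.
- exists setT, (fun _ _ => 0); split => //; first exact: openT.
    by move=> i; apply: (msmooth_cst _ openT).
  by move=> th x i _ _ _; rewrite /conj_twist mulmx0 mul0mx.
- rewrite /int_wedge -[RHS]int_coord0; apply: eq_int_coord => x _.
  by rewrite big1// => j _; rewrite c0 mulmx0 mxtrace0.
Qed.
End TangentSpace.

(** * The metric and the skew forms *)

Section Forms.
Variable R : realType.
Implicit Types (p q : hpair R) (c : R[i]) (x : 'rV[R]_3).
Local Notation C := R[i].
Local Notation M2 := 'M[C]_2.
Local Notation I_ := (@Complex R 0 1).
Local Notation rc r := (@Complex R r 0).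

(** The scalar function whose integral against the volume form is [int_star]. *)
Definition star_density p q x : C :=
  \sum_j rc (lam x ^- 2) * \tr (p.1 x j *m q.1 x j) + \tr (p.2 x *m q.2 x).

Lemma star_density_lin c p q x :
  star_density (padd (pscale c p) q) (padd (pscale c p) q) x
  = c * c * star_density p p x + 2 * c * star_density p q x + star_density q q x.
Proof.
have H (X Y : M2) : \tr ((c *: X + Y) *m (c *: X + Y))
    = c * c * \tr (X *m X) + 2 * c * \tr (X *m Y) + \tr (Y *m Y).
  rewrite mulmxDl !mulmxDr -!scalemxAl -!scalemxAr !mxtraceD !mxtraceZ (mxtrace_mulC Y X).
  by move: (\tr _) (\tr _) (\tr _) => t1 t2 t3; ring.
rewrite /star_density /= H (eq_bigr (fun j =>
    c * c * (rc (lam x ^- 2) * \tr (p.1 x j *m p.1 x j))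
    + 2 * c * (rc (lam x ^- 2) * \tr (p.1 x j *m q.1 x j))
    + rc (lam x ^- 2) * \tr (q.1 x j *m q.1 x j))); last first.
  by move=> j _; rewrite H !mulrDr; congr (_ + _ + _); rewrite mulrCA.
rewrite !big_split /= -!mulr_sumr.
move: (\sum_j _) (\sum_j _) (\sum_j _) (\tr _) (\tr _) (\tr _) => s1 s2 s3 t1 t2 t3.
by ring.
Qed.

(** The completeness relation of the Pauli matrices. *)
Lemma fierz (a b d e : 'I_2) :
  \sum_j cliff R j a b * cliff R j d e + (1%:M : M2) a b * (1%:M : M2) d e
  = 2 * ((a == b)%:R * (d == e)%:R - (a == e)%:R * (b == d)%:R).
Proof.
have ii := mul_ii R.
have one (k l : 'I_2) : (1%:M : M2) k l = (k == l)%:R by rewrite mxE.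
rewrite sum3E !one.
by elim/ord2_ind: a; elim/ord2_ind: b; elim/ord2_ind: d; elim/ord2_ind: e;
  rewrite !cliffE /=; ring: ii.
Qed.

Lemma tr_contractM (M N : M2) psi phi f g :
  \tr (spinor_contract M psi f *m spinor_contract N phi g)
  = \sum_a \sum_b \sum_d \sum_e (M a b * N d e)
      * (cospinor psi a * cospinor phi d * \tr (f b *m g e)).
Proof.
rewrite /spinor_contract mulmx_suml linear_sum; apply: eq_bigr => a _.
rewrite mulmx_suml linear_sum; apply: eq_bigr => b _.
rewrite mulmx_sumr linear_sum; apply: eq_bigr => d _.
rewrite mulmx_sumr linear_sum; apply: eq_bigr => e _ /=.
rewrite -!scalemxAl -!scalemxAr !mxtraceZ.
by move: (\tr _) => t; ring.
Qed.

(** The Fierz relation antisymmetrises the two spinors psi, phi, hence also f and g. *)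
Lemma fierz_contract psi phi f g :
  \sum_j \tr (spinor_contract (cliff R j) psi f *m spinor_contract (cliff R j) phi g)
    + \tr (spinor_contract 1%:M psi f *m spinor_contract 1%:M phi g)
  = 2 * (pairing psi phi * (\tr (f 0 *m g 1) - \tr (f 1 *m g 0))).
Proof.
under eq_bigr do rewrite tr_contractM.
rewrite tr_contractM exchange_big -big_split/=.
transitivity (\sum_a \sum_b \sum_d \sum_e
  (2 * ((a == b)%:R * (d == e)%:R - (a == e)%:R * (b == d)%:R))
      * (cospinor psi a * cospinor phi d * \tr (f b *m g e))).
  apply: eq_bigr => a _; rewrite exchange_big -big_split/=; apply: eq_bigr => b _.
  rewrite exchange_big -big_split/=; apply: eq_bigr => d _.
  rewrite exchange_big -big_split/=; apply: eq_bigr => e _.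
  by rewrite -fierz mulrDl mulr_suml.
have sum_det (K : comNzRingType) (w v : 'I_2 -> K) (t : 'I_2 -> 'I_2 -> K) :
    \sum_a \sum_b \sum_d \sum_e
      (2 * ((a == b)%:R * (d == e)%:R - (a == e)%:R * (b == d)%:R)) * (w a * v d * t b e)
    = 2 * ((w 0 * v 1 - w 1 * v 0) * (t 0 1 - t 1 0)) by rewrite !sum2E /=; ring.
rewrite (sum_det _ (cospinor psi) (cospinor phi) (fun b e => \tr (f b *m g e))).
rewrite /cospinor /pairing /=.
move: (\tr _) (\tr _) (psi 0 0) (psi 1 0) (phi 0 0) (phi 1 0).
by move=> *; ring.
Qed.

Lemma pairing_cliff_lin x a b (u v : 'cV[C]_2) :
  pairing (cliff_lin x a b *m u) (cliff_lin x a b *m v)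
  = (a * a + rc (nsq x) * b * b) * pairing u v.
Proof.
have ii := mul_ii R.
have E (k l : 'I_2) : cliff_lin x a b k l = a * (k == l)%:R + b * cliff_pos x k l.
  by rewrite /cliff_lin !mxE mulr_natr.
rewrite /pairing !mulmx2E !E !cliff_posE !cliffE rc_nsq /=.
move: (u 0 0) (u 1 0) (v 0 0) (v 1 0) (rc (x 0 0)) (rc (x 0 1)) (rc (x 0 2%:R)).
by move=> *; ring: ii.
Qed.

(** The matrix in [killing_formula] has determinant one. *)
Lemma killing_pairing s psi phi x : killing s psi -> killing s phi -> H3 x ->
  pairing (psi x) (phi x) = omegaK psi phi.
Proof.
move=> Kp Kf Hx; rewrite (killing_cliff_lin Kp Hx) (killing_cliff_lin Kf Hx) pairing_cliff_lin.
have e2 := killing_coef_sq R s.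
have hh : rc (conf_isqrt x) * rc (conf_isqrt x) * (1 - rc (nsq x)) = 1.
  rewrite -[in 1 - _]/(rc 1) -rcN -rcD -!rcM -expr2 /conf_isqrt exprVn sqr_sqrtr ?ltW ?H3_gt0//.
  by rewrite mulVf// lt0r_neq0// H3_gt0.
rewrite (_ : _ + _ = 1) ?mul1r// -[RHS]hh.
by ring: e2.
Qed.

Lemma star_density_clH s nu1 nu2 psi1 psi2 x : killing s psi1 -> killing s psi2 -> H3 x ->
  star_density (clH_inv (tensor nu1 psi1)) (clH_inv (tensor nu2 psi2)) x
  = 1 / 2 * (omegaK psi1 psi2 * \tr (nu1 x 0 *m nu2 x 1 - nu1 x 1 *m nu2 x 0)).
Proof.
move=> K1 K2 Hx; have l0 := rc_lam_neq0 Hx.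
rewrite /star_density !clH_inv2E -(killing_pairing K1 K2 Hx).
have -> : \tr (nu1 x 0 *m nu2 x 1 - nu1 x 1 *m nu2 x 0)
  = \tr (nu1 x 0 *m nu2 x 1) - \tr (nu1 x 1 *m nu2 x 0) by rewrite mxtraceD raddfN.
rewrite (_ : pairing _ _ * _ = 2^-1 * (2 * (pairing (psi1 x) (psi2 x)
   * (\tr (nu1 x 0 *m nu2 x 1) - \tr (nu1 x 1 *m nu2 x 0))))); last first.
  by rewrite [RHS]mulrA mulVf ?mul1r// pnatr_eq0.
rewrite -fierz_contract -scalemxAl -scalemxAr !mxtraceZ.
rewrite (eq_bigr (fun j => 1 / 4 * \tr (spinor_contract (cliff R j) (psi1 x) (nu1 x)
   *m spinor_contract (cliff R j) (psi2 x) (nu2 x)))); last first.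
  move=> j _; rewrite !clH_inv1E -scalemxAl -scalemxAr !mxtraceZ !mulrA; congr (_ * _).
  by rewrite rcV rcX; field.
rewrite -mulr_sumr; move: (\sum_j _) (\tr _) => t1 t2.
by field.
Qed.

Lemma int_starE p q : int_star p q = int_vol (star_density p q). Proof. by []. Qed.

Lemma int_star_eq p q f : (forall x, H3 x -> star_density p q x = f x) ->
  int_star p q = int_vol f.
Proof. by move=> E; rewrite int_starE; apply: eq_int_coord => x Hx; rewrite E. Qed.

Lemma int_vol0 : int_vol (fun _ : 'rV[R]_3 => 0 : C) = 0.
Proof. by rewrite -[RHS](int_coord0 R); apply: eq_int_coord => x _; rewrite mulr0. Qed.

Variables (n twop : nat) (m : hpair R).

Lemma gform_value s g p : is_gform n twop m s g -> tangent_pair n twop m p ->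
  gauge_fixed m s p -> g (tclass n twop m p) (tclass n twop m p) = - (1 / 2) * int_star p p.
Proof. by move=> [_ G] tp gp; apply: G => //; [exists p|apply: tclass_refl]. Qed.

Lemma star_density_null s nu1 nu2 psi x : killing s psi -> H3 x ->
  star_density (clH_inv (tensor nu1 psi)) (clH_inv (tensor nu2 psi)) x = 0.
Proof.
move=> K Hx; rewrite (star_density_clH _ _ K K Hx).
have -> : omegaK psi psi = 0 by rewrite /omegaK /pairing mulrC subrr.
by rewrite mul0r mulr0.
Qed.

Lemma gform_null s g nu psi : is_gform n twop m s g ->
  eigenspinor n twop m s nu -> killing s psi ->
  g (EK n twop m nu psi) (EK n twop m nu psi) = 0.
Proof.
move=> G E K; rewrite (gform_value G (clH_tangent E K) (gauge_fixed_clH E K)).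
rewrite (int_star_eq (f := fun=> 0)) ?int_vol0 ?mulr0// => x Hx.
exact: (star_density_null nu nu K Hx).
Qed.

(** Both classes are null, so only the cross term of g (c X1 + X2, c X1 + X2) remains, in g as
    well as under the integral. *)
Lemma gform_polar s g nu1 nu2 psi1 psi2 c : is_gform n twop m s g ->
  eigenspinor n twop m s nu1 -> eigenspinor n twop m s nu2 ->
  killing s psi1 -> killing s psi2 ->
  2 * c * g (EK n twop m nu1 psi1) (EK n twop m nu2 psi2)
  = - (1 / 2) * int_vol (fun x => c * omegaK psi1 psi2
       * \tr (nu1 x 0 *m nu2 x 1 - nu1 x 1 *m nu2 x 0)).
Proof.
move=> G E1 E2 K1 K2; have [[sym bil] _] := G.
set p1 := clH_inv (tensor nu1 psi1); set p2 := clH_inv (tensor nu2 psi2).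
have t1 : tangent_pair n twop m p1 := clH_tangent E1 K1.
have t2 : tangent_pair n twop m p2 := clH_tangent E2 K2.
have t := tangent_lin c t1 t2.
have gf := gauge_fixed_lin c t1 t2 (gauge_fixed_clH E1 K1) (gauge_fixed_clH E2 K2).
have TX1 : TC n twop m (tclass n twop m p1) by exists p1.
have TX2 : TC n twop m (tclass n twop m p2) by exists p2.
have TY : TC n twop m (tclass n twop m (padd (pscale c p1) p2)) by exists (padd (pscale c p1) p2).
have n1 : g (tclass n twop m p1) (tclass n twop m p1) = 0 := gform_null G E1 K1.
have n2 : g (tclass n twop m p2) (tclass n twop m p2) = 0 := gform_null G E2 K2.
have V := gform_value G t gf.
have e1 := bil c p1 p2 _ t1 t2 TX1; have e2 := bil c p1 p2 _ t1 t2 TX2.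
have e3 := bil c p1 p2 _ t1 t2 TY.
have polar X1 X2 Y v : g X1 Y = g Y X1 -> g X2 Y = g Y X2 -> g X2 X1 = g X1 X2 ->
    g X1 X1 = 0 -> g X2 X2 = 0 -> g Y X1 = c * g X1 X1 + g X2 X1 ->
    g Y X2 = c * g X1 X2 + g X2 X2 -> g Y Y = c * g X1 Y + g X2 Y -> g Y Y = v ->
    2 * c * g X1 X2 = v.
  move=> s1 s2 s21 z1 z2 y1 y2 y <-; rewrite y s1 s2 y1 y2 z1 z2 s21.
  by move: (g X1 X2) => u; ring.
rewrite -[EK n twop m nu1 psi1]/(tclass n twop m p1) -[EK n twop m nu2 psi2]/(tclass n twop m p2).
transitivity (- (1 / 2) * int_star (padd (pscale c p1) p2) (padd (pscale c p1) p2)).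
  exact: (polar _ _ _ _ (sym _ _ TX1 TY) (sym _ _ TX2 TY) (sym _ _ TX2 TX1) n1 n2 e1 e2 e3 V).
congr (_ * _); apply: int_star_eq => x Hx; rewrite star_density_lin.
rewrite (star_density_null _ _ K1 Hx) (star_density_null _ _ K2 Hx).
rewrite (star_density_clH _ _ K1 K2 Hx); move: (\tr _) => t0.
by field.
Qed.
End Forms.

Theorem theorem4 (R : realType) (n twop : nat) (n_gt0 : (0 < n)%N)
    (twop_gt0 : (0 < twop)%N)
    (x : set (hpair R)) (x_in : framed_moduli n twop x)
    (m : hpair R) (m_in : x m) :
  (forall (s : bool) (g : set (hpair R) -> set (hpair R) -> R[i]),
     is_gform n twop m s g ->
     forall (nu1 nu2 : tspinor R) (psi1 psi2 : spinor R),
       eigenspinor n twop m s nu1 -> eigenspinor n twop m s nu2 ->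
       killing s psi1 -> killing s psi2 ->
       g (EK n twop m nu1 psi1) (EK n twop m nu2 psi2)
       = 1 / 2 * (omegaE nu1 nu2 * omegaK psi1 psi2))
  /\
  (forall psi : spinor R, killing true psi -> (exists2 y, H3 y & psi y != 0) ->
     forall g : set (hpair R) -> set (hpair R) -> R[i],
       is_gform n twop m true g ->
       forall X : set (hpair R), T10 n twop m psi X -> g X X = 0).
Proof.
split=> [s g G nu1 nu2 psi1 psi2 E1 E2 K1 K2|psi K _ g G X [nu E ->]]; last first.
  exact: (gform_null G E K).
have [k0|k0] := eqVneq (omegaK psi1 psi2) 0.
  have := gform_polar 1 G E1 E2 K1 K2; rewrite k0.
  rewrite (_ : (fun y => _ * \tr _) = fun=> 0); last first.
    by apply/funext => y; rewrite mulr0 mul0r.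
  rewrite int_vol0 !mulr0 mulr1 => /eqP; rewrite mulf_eq0 pnatr_eq0 /= => /eqP ->.
  by [].
(* With this scaling the integrand is the one in omegaE. *)
have := gform_polar (omegaK psi1 psi2)^-1 G E1 E2 K1 K2; rewrite mulVf//.
rewrite (_ : (fun y => 1 * _) = fun y => \tr (nu1 y 0 *m nu2 y 1 - nu1 y 1 *m nu2 y 0)); last first.
  by apply/funext => y; rewrite mul1r.
rewrite -[RHS in _ = RHS -> _]/(omegaE nu1 nu2) => <-.
move: (g _ _) (omegaK _ _) k0 => v k k0.
by field.
Qed.
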